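(* Let $(K,v,w)$ be a finite bi-pointed $\square$-set whose non-looping length covering is proper, and let \[ \partial_n:H_n(|\mathrm{Ch}^{\le n}(K)_v^w|,|\mathrm{Ch}^{<n}(K)_v^w|)\to H_{n-1}(|\mathrm{Ch}^{\le n-1}(K)_v^w|,|\mathrm{Ch}^{<n-1}(K)_v^w|) \] be the differential in the cellular chain complex of the CW-complex $|\mathrm{Ch}(K)_v^w|$. For a cube chain $\mathbf c\in\mathrm{Ch}^{=n}(K)_v^w$ of type $(n_1,\dots,n_l)$ we have \[ \partial_n(g_{\mathbf c})=\sum_{k=1}^{l}\ \sum_{r=1}^{n_k-1}\ \sum_{A\subseteq\{1,\dots,n_k\},\ |A|=r}(-1)^{n_1+\dots+n_{k-1}+k+r+1}\,\mathrm{sgn}(A)\, g_{d_{k,A}(\mathbf c)}, \] where $\mathrm{sgn}(A)=1$ if $\sum_{i\in A}i\equiv\sum_{i=1}^r i \pmod 2$ and $\mathrm{sgn}(A)=-1$ otherwise.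
   Context: **$\square$-sets.** A pre-cubical set ($\square$-set) $K$ is a sequence of pairwise disjoint sets $K[n]$, $n\ge 0$, with face maps $d_i^\varepsilon:K[n]\to K[n-1]$ ($\varepsilon\in\{0,1\}$, $1\le i\le n$) satisfying $d^\varepsilon_id^\eta_j=d^\eta_{j-1}d^\varepsilon_i$ for $i<j$. Elements of $K[n]$ are $n$-cubes, $0$-cubes are vertices. $K$ is finite if it has finitely many cubes. A bi-pointed $\square$-set is a triple $(K,v,w)$ with $v,w\in K[0]$. For $f:\{1,\dots,n\}\to\{0,1,*\}$ with $|f^{-1}( * )|=m$ put $d_f=d_1^{f(1)}\cdots d_n^{f(n)}:K[n]\to K[m]$, where $d_i^*$ means the identity. Write $d^0_A=d_f$ if $f=0$ on $A$ and $f=*$ elsewhere, $d^1_A=d_f$ if $f=1$ on $A$ and $f=*$ elsewhere, and $d^\varepsilon=d^\varepsilon_{\{1,\dots,n\}}:K[n]\to K[0]$. **Proper, covering.** $K$ is proper if the map $\coprod_{n\ge0}K[n]\to 2^{K[0]}$, $c\mapsto\{d^0(c),d^1(c)\}$, is injective. The non-looping length covering of $K$ is the $\square$-set $\tilde K$ with $\tilde K[n]=K[n]\times\mathbb Z$ and $d_i^\varepsilon(c,k)=(d_i^\varepsilon(c),k+\varepsilon)$. **Cube chains.** A cube chain in $K$ from $v$ to $w$ is a sequence $\mathbf c=(c_1,\dots,c_l)$, $c_k\in K[n_k]$, $n_k>0$, with $d^0(c_1)=v$, $d^1(c_l)=w$, $d^1(c_i)=d^0(c_{i+1})$ for $1\le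 i<l$ (the empty sequence is a cube chain from $v$ to $w$ exactly when $v=w$). Its type is $(n_1,\dots,n_l)$ and its dimension is $n_1+\dots+n_l-l$. $\mathrm{Ch}(K)_v^w$ is the set of all of them; $\mathrm{Ch}^{=m}$, $\mathrm{Ch}^{\le m}$, $\mathrm{Ch}^{<m}$ denote the subsets of chains of dimension $=m$, $\le m$, $<m$. For $1\le k\le l$ and $A\subseteq\{1,\dots,n_k\}$ with $0<|A|<n_k$, $\bar A=\{1,\dots,n_k\}\setminus A$, let $d_{k,A}(\mathbf c)=(c_1,\dots,c_{k-1},d^0_{\bar A}(c_k),d^1_A(c_k),c_{k+1},\dots,c_l)$. $\mathrm{Ch}(K)_v^w$ is partially ordered by the reflexive-transitive closure of the relations $d_{k,A}(\mathbf c)\le\mathbf c$; $\mathrm{Ch}_{\le\mathbf c}$, $\mathrm{Ch}_{<\mathbf c}$ are the subposets of elements $\le\mathbf c$, resp. $<\mathbf c$. For a poset $P$, $|P|$ is the geometric realization of its order complex. Under the hypotheses of the theorem, $|\mathrm{Ch}(K)_v^w|$ is a regular CW-complex with closed $d$-cells $|\mathrm{Ch}_{\le\mathbf c}(K)_v^w|$, $\mathbf c\in\mathrm{Ch}^{=d}(K)_v^w$; its $n$-skeleton is $|\mathrm{Ch}^{\le n}(K)_v^w|$. **The generators $g_{\mathbf c}$.** Let $\mathbf c=(c_1,\dots,c_l)$ have type $\mathbf n=(n_1,\dots,n_l)$ and dimension $n$; put $N=n_1+\dots+n_l=n+l$, $b_k=n_1+\dots+n_k$, and let $f_{\mathbf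 n}:\{1,\dots,N\}\to\{1,\dots,l\}$ be given by $f_{\mathbf n}(i)=k$ iff $b_{k-1}<i\le b_k$. Let $O_N$ be the poset of all surjections $f:\{1,\dots,N\}\to\{1,\dots,k(f)\}$ ($k(f)\geq 1$ depending on $f$), with $f\preceq g$ iff $g=h\circ f$ for some non-decreasing $h$. Let $O_{\mathbf n}=\{f\in O_N: f\preceq f_{\mathbf n}\}$. For $f\in O_{\mathbf n}$ with $f_{\mathbf n}=h\circ f$ and $1\le k\le l$, let $f^k\in O_{n_k}$ be $f^k(i)=f(i+b_{k-1})+1-\min h^{-1}(k)$. For $s\in\mathbb Z$ let $\mathsf u_s(i)=0$ if $i>s$, $\mathsf u_s(i)=1$ if $i<s$, $\mathsf u_s(s)=*$. For a cube $c\in K[m]$, $m>0$, and $f\in O_m$ let $I_c(f)=(d_{\mathsf u_1f}(c),\dots,d_{\mathsf u_{k(f)}f}(c))$, and for $f\in O_{\mathbf n}$ let $I_{\mathbf c}(f)\in\mathrm{Ch}_{\le\mathbf c}(K)_v^w$ be the concatenation of the sequences $I_{c_1}(f^1),\dots,I_{c_l}(f^l)$. The map $I_{\mathbf c}$ is order preserving. Let $\Sigma_{\mathbf n}$ be the set of permutations $\sigma$ of $\{1,\dots,N\}$ with $f_{\mathbf n}\sigma=f_{\mathbf n}$. Let $T_{\mathbf n}$ be the set of functions $\tau:\{1,\dots,N-1\}\to\{0,\dots,n+1\}$ attaining every value $1,\dots,n$ and with $\tau(b_k)=n+1$ for $1\le k\le l-1$. Such a $\tau$ restricts to a bijection $\{1,\dots,N-1\}\setminus\{b_1,\dots,b_{l-1}\}\to\{1,\dots,n\}$;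 let $\mathrm{sgn}_{\mathbf n}(\tau)$ be the sign of the permutation of $\{1,\dots,n\}$ obtained by precomposing it with the increasing bijection $\{1,\dots,n\}\to\{1,\dots,N-1\}\setminus\{b_1,\dots,b_{l-1}\}$. For $0\le j\le n$ let $f^\tau_j\in O_{\mathbf n}$ be $f_j^\tau(i)=1+|\{i'<i:\tau(i')>j\}|$. Then \[ g_{\mathbf c}=\sum_{\sigma\in\Sigma_{\mathbf n}}\sum_{\tau\in T_{\mathbf n}}\mathrm{sgn}(\sigma)\,\mathrm{sgn}_{\mathbf n}(\tau)\,\bigl(I_{\mathbf c}(f^\tau_0\sigma),I_{\mathbf c}(f^\tau_1\sigma),\dots,I_{\mathbf c}(f^\tau_n\sigma)\bigr), \] a simplicial $n$-chain (simplices ordered increasingly) in the order complex of $\mathrm{Ch}_{\le\mathbf c}(K)_v^w$; it is a cycle relative to $\mathrm{Ch}_{<\mathbf c}(K)_v^w$ representing a generator of $H_n(|\mathrm{Ch}_{\le\mathbf c}(K)_v^w|,|\mathrm{Ch}_{<\mathbf c}(K)_v^w|)$. The same symbol $g_{\mathbf c}$ denotes its class in $H_n(|\mathrm{Ch}^{\le n}(K)_v^w|,|\mathrm{Ch}^{<n}(K)_v^w|)$, which is free abelian on the $g_{\mathbf c}$, $\mathbf c\in\mathrm{Ch}^{=n}(K)_v^w$. *)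

(* Defs.v *)
From HB Require Import structures.
From mathcomp Require Import all_boot all_order all_algebra perm.
From mathcomp Require Import generic_quotient ring_quotient.
From mathcomp Require Import all_classical all_reals all_analysis.
From mathcomp Require Import freeg zify.
From Stdlib Require Import Relation_Operators.

Set Implicit Arguments.
Unset Strict Implicit.
Unset Printing Implicit Defensive.
Import Order.TTheory GRing.Theory Num.Theory.
Import numFieldNormedType.Exports.
Local Open Scope classical_set_scope.
Local Open Scope quotient_scope.
Local Open Scope ring_scope.

Definition std_simplex (R : realType) (n : nat) : set 'rV[R]_n.+1 :=
  [set t | (forall i, 0 <= t 0 i) /\ \sum_i t 0 i = 1].
Arguments std_simplex : clear implicits.

Section Coface.
Variable R : realType.

Definition push_coord (m n : nat) (h : 'I_m.+1 -> 'I_n.+1) (t : 'rV[R]_m.+1) :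
  'rV[R]_n.+1 := \row_k \sum_(j | h j == k) t 0 j.

Lemma push_coord_simplex m n (h : 'I_m.+1 -> 'I_n.+1) (t : std_simplex R m) :
  push_coord h (val t) \in std_simplex R n.
Proof.
case: t => t /= /set_mem [t0 t1]; apply/mem_set; split.
  by move=> i; rewrite mxE sumr_ge0.
rewrite -[RHS]t1 (partition_big h xpredT) //=.
by apply: eq_bigr => i _; rewrite mxE.
Qed.

(* The affine map of standard simplices that sends vertex j to vertex h j. *)
Definition simplex_map m n (h : 'I_m.+1 -> 'I_n.+1) (t : std_simplex R m) :
  std_simplex R n := SigSub (push_coord_simplex h t).

Lemma simplex_map_comp m n p (g : 'I_n.+1 -> 'I_p.+1) (h : 'I_m.+1 -> 'I_n.+1) :
  simplex_map g \o simplex_map h = simplex_map (g \o h).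
Proof.
apply/funext => t; apply: val_inj; apply/rowP => k /=; rewrite !mxE.
rewrite (partition_big h (fun i => g i == k)) //=.
apply: eq_bigr => i /eqP gi; rewrite mxE; apply: eq_bigl => j /=.
by case: (eqVneq (h j) i) => [->|]; rewrite ?andbF // gi eqxx.
Qed.

End Coface.

Lemma alternating_sum0 (V : zmodType) m (F : 'I_m.+2 -> 'I_m.+1 -> V) :
  (forall (i i' : 'I_m.+2) (j j' : 'I_m.+1),
     i = j'.+1 :> nat -> j = i' :> nat -> (j < i)%N -> F i j = - F i' j') ->
  \sum_i \sum_j F i j = 0.
Proof.
move=> FN; rewrite pair_big /= (bigID (fun p : 'I_m.+2 * 'I_m.+1 => p.2 < p.1)%N) /=.
pose h (p : 'I_m.+2 * 'I_m.+1) : 'I_m.+2 * 'I_m.+1 :=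
  (fintype.lift ord0 p.2, inord p.1).
pose g (p : 'I_m.+2 * 'I_m.+1) : 'I_m.+2 * 'I_m.+1 :=
  (inord p.2, inord p.1.-1).
rewrite (reindex_onto h g) /=; last first.
  move=> [i j] /= ji; congr pair; apply: val_inj; rewrite /= ?inordK //.
  - by rewrite /bump /= add1n prednK // (leq_trans _ ji).
  - by case: i ji => [[|i] ?].
  - by rewrite (ltn_trans (ltn_ord j)).
  - by rewrite (ltn_trans (ltn_ord j)).
rewrite [X in X + _](_ : _ =
    \sum_(p : 'I_m.+2 * 'I_m.+1 | ~~ (p.2 < p.1)%N) F (h p).1 (h p).2); last first.
  apply: eq_bigl => -[i j] /=.
  rewrite /bump /= add1n -leqNgt.
  have [ij|ij] := leqP i j.
    have im : (i < m.+1)%N by rewrite (leq_ltn_trans ij).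
    rewrite inordK // ltnS ij xpair_eqE /h /=.
    have -> : inord j.+1.-1 = j by apply: val_inj; rewrite /= inordK.
    rewrite eqxx andbT; apply/eqP; apply: val_inj.
    by rewrite /= !inordK // (ltn_trans im).
  apply/negbTE.
  apply/negP => /andP [i1 /eqP [/(congr1 val) /= ii _]].
  rewrite inordK in ii; last by rewrite (ltn_trans (ltn_ord (inord i))).
  by move: i1; rewrite ii ltnS leqNgt ij.
rewrite -big_split big1 //= => -[i j] /=; rewrite -leqNgt => ij.
have im : (i < m.+1)%N by rewrite (leq_ltn_trans ij).
rewrite (FN _ i _ j) ?addNr //= ?inordK //.
Qed.

Section SingularHomology.
Variables (R : realType) (X : topologicalType).

(* The free abelian group on all maps from the standard n-simplex to X; the   *)
(* group of singular n-chains of a subspace A is the subgroup singular_in A.  *)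
Definition chain (n : nat) := {freeg (std_simplex R n -> X) / int}.

Definition singular_in (A : set X) (n : nat) : {pred chain n} :=
  fun z => `[< forall s, s \in dom z -> continuous s /\ range s `<=` A >].

Lemma singular_in_zmod A n : zmod_closed (@singular_in A n).
Proof.
split; first by apply/asboolP => s; rewrite dom0.
move=> x y /asboolP Ax /asboolP Ay; apply/asboolP => s /domB.
by rewrite mem_cat => /orP [/Ax|/Ay].
Qed.
HB.instance Definition _ A n :=
  GRing.isZmodClosed.Build (chain n) (@singular_in A n) (@singular_in_zmod A n).

Definition singular_face n (i : 'I_n.+2) (s : std_simplex R n.+1 -> X) :=
  s \o simplex_map (fintype.lift i).

Definition boundary n : chain n.+1 -> chain n :=
  fglift (fun s => \sum_(i < n.+2) << (-1) ^+ i *g singular_face i s >>).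
Arguments boundary : simpl never.

Lemma boundary_is_zmod n : zmod_morphism (@boundary n).
Proof. exact: lift_is_additive. Qed.
HB.instance Definition _ n :=
  GRing.isZmodMorphism.Build (chain n.+1) (chain n) (@boundary n)
    (@boundary_is_zmod n).

Lemma boundaryU n k (s : std_simplex R n.+1 -> X) :
  boundary << k *g s >> =
  \sum_(i < n.+2) << k * (-1) ^+ i *g singular_face i s >>.
Proof.
rewrite /boundary liftU scaler_sumr; apply: eq_bigr => i _.
by apply/eqP/freeg_eqP => x; rewrite coeffZ !coeffU mulrA.
Qed.

Lemma boundary_boundary n (z : chain n.+2) : boundary (boundary z) = 0.
Proof.
suff bb k (s : std_simplex R n.+2 -> X) : boundary (boundary << k *g s >>) = 0.
  by rewrite -[z]freeg_sumE !raddf_sum big1_seq // => s _; exact: bb.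
rewrite boundaryU raddf_sum /=.
under eq_bigr do rewrite boundaryU.
apply: alternating_sum0 => i i' j j' ij ji lt_ji.
rewrite freegUN ij ji; congr << _ *g _ >>.
  by rewrite exprS mulN1r mulrN mulNr mulrAC.
suff E : simplex_map (fintype.lift i) \o simplex_map (fintype.lift j) =
    simplex_map (fintype.lift i') \o simplex_map (fintype.lift j')
    :> (std_simplex R n -> _).
  by apply/funext => t; congr s; exact: (congr1 (@^~ t) E).
rewrite !simplex_map_comp; congr simplex_map.
apply/funext => p; apply: val_inj; rewrite /= /bump ij ji.
move: lt_ji; rewrite ij ji ltnS; move: (p : nat) (i' : nat) (j' : nat); lia.
Qed.

(* The boundary in every degree; it vanishes in degree 0, where n.-1 = 0. *)
Definition bnd (n : nat) : chain n -> chain n.-1 :=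
  if n is m.+1 then @boundary m else fun=> 0.

Lemma bnd_is_zmod n : zmod_morphism (@bnd n).
Proof.
by case: n => [|n] x y; rewrite /bnd ?subr0 //; exact: boundary_is_zmod.
Qed.
HB.instance Definition _ n :=
  GRing.isZmodMorphism.Build (chain n) (chain n.-1) (@bnd n) (@bnd_is_zmod n).

Lemma bnd_bnd n (z : chain n) : bnd (bnd z) = 0.
Proof. by case: n z => [|[|n]] z //; exact: boundary_boundary. Qed.

Section Pair.
Variables (n : nat) (A B : set X).

Definition relative_cycles : {pred chain n} :=
  [pred z | (z \in @singular_in A n) && (bnd z \in @singular_in B n.-1)].

Lemma relative_cycles_zmod : zmod_closed relative_cycles.
Proof.
split=> [|x y]; rewrite !inE.
  by rewrite raddf0; apply/andP; split; exact: rpred0.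
move=> /andP [xA xB] /andP [yA yB].
by rewrite raddfB; apply/andP; split; exact: rpredB.
Qed.
HB.instance Definition _ :=
  GRing.isZmodClosed.Build (chain n) relative_cycles relative_cycles_zmod.

Definition relative_cycle := {z : chain n | z \in relative_cycles}.
HB.instance Definition _ := SubChoice.on relative_cycle.
HB.instance Definition _ := [SubChoice_isSubZmodule of relative_cycle by <:].

Definition relative_boundaries : {pred relative_cycle} :=
  fun z => `[< exists (y : chain n.+1) (b : chain n),
    [/\ y \in @singular_in A n.+1, b \in @singular_in B n
       & val z = boundary y + b] >].

Lemma relative_boundaries_zmod : zmod_closed relative_boundaries.
Proof.
split.
  apply/asboolP; exists 0, 0; split; [exact: rpred0 | exact: rpred0 |].
  by rewrite !raddf0 addr0.
move=> x x' /asboolP [y [b [yA bB e]]] /asboolP [y' [b' [yA' bB' e']]].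
apply/asboolP; exists (y - y'), (b - b'); split; [exact: rpredB | exact: rpredB |].
by rewrite !raddfB /= e e' opprD addrACA.
Qed.
HB.instance Definition _ :=
  GRing.isZmodClosed.Build relative_cycle relative_boundaries
    relative_boundaries_zmod.

(* H_n(A, B), as relative cycles modulo relative boundaries. *)
Definition homology : zmodType := Quotient.quot relative_boundaries.

(* The class of a relative cycle; a chain that is not one is sent to 0. *)
Definition homology_class (z : chain n) : homology :=
  \pi_(Quotient.quot relative_boundaries) (insubd (0 : relative_cycle) z).

End Pair.

(* The map H_n(A, B) -> H_(n-1)(B) -> H_(n-1)(A', B'), [z] |-> [bnd z], for   *)
(* B contained in A'.                                                         *)
Lemma bnd_relative_cycle n A B A' B' (z : relative_cycle n A B) :
  B `<=` A' -> bnd (val z) \in @relative_cycles n.-1 A' B'.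
Proof.
move=> BA'; case: z => z /= /andP [_ /asboolP zB]; apply/andP; split.
  apply/asboolP => s /zB [sc sB]; split=> //; exact: subset_trans BA'.
by rewrite bnd_bnd rpred0.
Qed.

Definition connecting_map n A B A' B' (BA' : B `<=` A') (x : homology n A B) :
  homology n.-1 A' B' :=
  \pi_(Quotient.quot (@relative_boundaries n.-1 A' B'))
    (Sub (bnd (val (repr (x : Quotient.quot (@relative_boundaries n A B)))))
         (bnd_relative_cycle B' _ BA')).

Lemma connecting_class n A B A' B' (BA' : B `<=` A') (z : chain n) :
  z \in @relative_cycles n A B ->
  connecting_map B' BA' (homology_class A B z) = homology_class A' B' (bnd z).
Proof.
move=> zAB; rewrite /connecting_map /homology_class.
set p := insubd _ z; set q := insubd _ (bnd z).
have pE : val p = z by rewrite val_insubd zAB.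
have qE : val q = bnd z.
  by rewrite val_insubd -pE (bnd_relative_cycle B' p BA').
apply/eqP; rewrite -Quotient.idealrBE; apply/asboolP.
have : p - repr (\pi_(Quotient.quot (@relative_boundaries n A B)) p)
    \in @relative_boundaries n A B.
  by rewrite Quotient.idealrBE reprK.
move: (repr _) => r /asboolP [y [b [yA bB e]]].
suff [y' [b' [yA' bB' e']]] : exists (y' : chain n.-1.+1) (b' : chain n.-1),
    [/\ y' \in @singular_in A' n.-1.+1, b' \in @singular_in B' n.-1
       & bnd (- (boundary y + b)) = boundary y' + b'].
  exists y', b'; split=> //; rewrite -e' -e raddfN /= !raddfB /=.
  by rewrite opprK [RHS]addrC; congr (_ - _); rewrite [LHS]qE pE.
case: n z A B A' B' BA' p q pE qE r y b yA bB e zAB => [|n] z A B A' B' BA' p q.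
  move=> _ _ r y b _ _ _ _; exists 0, 0.
  by split; [exact: rpred0 | exact: rpred0 | rewrite !raddf0 addr0].
move=> _ _ r y b yA /asboolP bB e _; exists (- b), 0; split.
- rewrite rpredN; apply/asboolP => s /bB [sc sB].
  by split=> //; exact: subset_trans BA'.
- exact: rpred0.
- by rewrite addr0 !raddfN raddfD /= boundary_boundary add0r.
Qed.

End SingularHomology.

(* A copy of T -> R that gives its subset |P| the weak topology: a set is     *)
(* open when its trace on every simplex of P is open.                         *)
Definition realization_space (R : realType) (T : choiceType)
  (le : T -> T -> Prop) (P : set T) : Type := T -> R.
HB.instance Definition _ R T le P := Choice.on (@realization_space R T le P).

Section Realization.
Variables (R : realType) (T : choiceType) (le : T -> T -> Prop).

(* Increasing (possibly degenerate) n-simplices of the subposet P. *)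
Definition flag (P : set T) (n : nat) (x : 'I_n.+1 -> T) :=
  (forall i, P (x i)) /\ (forall i j : 'I_n.+1, (i <= j)%N -> le (x i) (x j)).

(* The affine simplex with vertices x 0, ..., x n: points of the realization  *)
(* are given by their barycentric coordinates, as functions T -> R.           *)
Definition affine_simplex n (x : 'I_n.+1 -> T) (t : std_simplex R n) : T -> R :=
  fun y => \sum_(i | x i == y) val t 0 i.

(* The union of the simplices of the order complex of P. *)
Definition realization (P : set T) : set (T -> R) :=
  [set p | exists n (x : 'I_n.+1 -> T), flag P x /\ range (affine_simplex x) p].

Section Topology.
Variable P : set T.

Definition realization_open (U : set (realization_space R le P)) :=
  forall n (x : 'I_n.+1 -> T), flag P x ->
    open (affine_simplex x @^-1` U : set (std_simplex R n)).

Lemma realization_openT : realization_open setT.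
Proof. by move=> n x _; rewrite preimage_setT; exact: openT. Qed.

Lemma realization_openI : setI_closed realization_open.
Proof.
by move=> U V oU oV n x xP; rewrite preimage_setI; apply: openI; auto.
Qed.

Lemma realization_open_bigU (I : Type) (f : I -> set (realization_space R le P)) :
  (forall i, realization_open (f i)) -> realization_open (\bigcup_i f i).
Proof.
move=> fo n x xP; rewrite preimage_bigcup.
by apply: bigcup_open => i _; exact: fo.
Qed.

HB.instance Definition _ := isOpenTopological.Build (realization_space R le P)
  realization_openT realization_openI realization_open_bigU.

End Topology.
End Realization.

(* The disjoint sets K[n] are the fibres of cube_dim. The face maps d_(i+1)^0 *)
(* and d_(i+1)^1 are (face false i) and (face true i), for i < cube_dim c;    *)
(* the values of (face e i c) for i >= cube_dim c are irrelevant.             *)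
Record precubical := Precubical {
  cube :> choiceType;
  cube_dim : cube -> nat;
  face : bool -> nat -> cube -> cube;
  dim_face : forall e i c, (i < cube_dim c)%N ->
    cube_dim (face e i c) = (cube_dim c).-1;
  faceC : forall e h i j c, (i < j < cube_dim c)%N ->
    face e i (face h j c) = face h j.-1 (face e i c) }.

Section Precubical.
Variable K : precubical.
Implicit Types (c v w : K).

(* d_f, for f with values in {0, 1, *}: Some false, Some true, None.          *)
Definition dface c (f : 'I_(cube_dim c) -> option bool) : K :=
  foldr (fun i c' => if f i is Some e then face e i c' else c') c
    (enum 'I_(cube_dim c)).

Definition dface_on (e : bool) c (A : {set 'I_(cube_dim c)}) : K :=
  dface (fun i => if i \in A then Some e else None).
Definition vertex (e : bool) c : K := dface (c := c) (fun=> Some e).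

Definition is_proper :=
  injective (fun c => [set vertex false c; vertex true c] : set K).

Definition covering_face (e : bool) i (ck : K * int) : K * int :=
  (face e i ck.1, ck.2 + (e : nat)%:Z).

Lemma covering_dim_face e i (ck : K * int) : (i < cube_dim ck.1)%N ->
  cube_dim (covering_face e i ck).1 = (cube_dim ck.1).-1.
Proof. exact: dim_face. Qed.

Lemma covering_faceC e h i j (ck : K * int) : (i < j < cube_dim ck.1)%N ->
  covering_face e i (covering_face h j ck) =
  covering_face h j.-1 (covering_face e i ck).
Proof. by move=> ij; rewrite /covering_face /= faceC // addrAC. Qed.

Definition length_covering : precubical :=
  Precubical (cube_dim := fun ck : (K * int)%type => cube_dim ck.1)
    covering_dim_face covering_faceC.

Fixpoint is_cube_chain v (s : seq K) w : bool :=
  if s is c :: s' then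
    [&& (0 < cube_dim c)%N, vertex false c == v
      & is_cube_chain (vertex true c) s' w]
  else v == w.

Definition Ch v w : set (seq K) := [set s | is_cube_chain v s w].

Definition chain_type (s : seq K) : seq nat := [seq cube_dim c | c <- s].
Definition chain_dim (s : seq K) : nat := sumn (chain_type s) - size s.

Definition Ch_le v w n : set (seq K) :=
  Ch v w `&` [set s | (chain_dim s <= n)%N].
Definition Ch_lt v w n : set (seq K) :=
  Ch v w `&` [set s | (chain_dim s < n)%N].

Definition nth_cube (s : seq K) (k : 'I_(size s)) : K := tnth (in_tuple s) k.

(* d_(k+1,A)(s); the elements of A are counted from 0 as well. *)
Definition subdivide (s : seq K) (k : 'I_(size s))
    (A : {set 'I_(cube_dim (nth_cube k))}) : seq K :=
  take k s ++ [:: dface_on false (~: A); dface_on true A] ++ drop k.+1 s.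

Definition subdivision (s' s : seq K) :=
  exists (k : 'I_(size s)) (A : {set 'I_(cube_dim (nth_cube k))}),
    (0 < #|A| < cube_dim (nth_cube k))%N /\ s' = subdivide A.

Definition chain_le : seq K -> seq K -> Prop :=
  clos_refl_trans (seq K) subdivision.

(* Positions 1, ..., N are counted from 0, so that the i-th position of the   *)
(* k-th block (both from 0) is (flatten_index typ k i), and f_n is            *)
(* (reshape_index typ) up to the shift of its values. Surjections in O_N are  *)
(* functions nat -> nat read on the positions i < N, with values from 1.      *)
Definition u (s a : nat) : option bool :=
  if a == s then None else Some (a < s)%N.

(* k(f) is the largest value of the surjection f. *)
Definition I_cube c (f : nat -> nat) : seq K :=
  [seq dface (fun i : 'I_(cube_dim c) => u s (f i))
     | s <- iota 1 (\max_(i < cube_dim c) f i)].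

(* f^k: if f_n = h \o f, then h^-1(k) is the set of values of f on block k. *)
Definition block_fun (typ : seq nat) (f : nat -> nat) (k i : nat) : nat :=
  let fk j := f (flatten_index typ k j) in
  (fk i + 1 - \big[minn/fk 0]_(j < nth 0 typ k) fk j)%N.

Definition I_chain (s : seq K) (f : nat -> nat) : seq K :=
  flatten [seq I_cube (nth_cube k) (block_fun (chain_type s) f k)
             | k <- enum 'I_(size s)].

Section Generators.
Variables (typ : seq nat) (n : nat).
Let N := sumn typ.

Definition block_perm (sigma : 'S_N) : bool :=
  [forall i, reshape_index typ (sigma i) == reshape_index typ i].

Definition perm_nat (sigma : 'S_N) (i : nat) : nat :=
  if insub i is Some i' then sigma i' else i.

(* The numbers b_1, ..., b_(l-1). *)
Definition breaks : seq nat :=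
  [seq sumn (take k typ) | k <- iota 1 (size typ).-1].

(* The domain {1, ..., N-1} of tau is counted from 0. *)
Definition T_n : {pred {ffun 'I_N.-1 -> 'I_n.+2}} :=
  fun tau =>
    [forall j : 'I_n.+2, (0 < j <= n)%N ==> [exists i, tau i == j]] &&
    [forall i : 'I_N.-1, (i.+1 \in breaks) ==> (tau i == n.+1 :> nat)].

(* The sign of the permutation of {1, ..., n} that lists the values of tau    *)
(* off the breaks in the order of their positions.                            *)
Definition sgn_n (tau : {ffun 'I_N.-1 -> 'I_n.+2}) : int :=
  if [pick p : 'S_n | [seq (p i).+1 | i : 'I_n] ==
        [seq tau i : nat | i : 'I_N.-1 <- enum 'I_N.-1 & i.+1 \notin breaks]]
  is Some p
  then (-1) ^+ p else 0.

Definition f_tau (tau : {ffun 'I_N.-1 -> 'I_n.+2}) (j i : nat) : nat :=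
  #|[pred i' : 'I_N.-1 | (i' < i)%N && (j < tau i')%N]|.+1.

End Generators.

(* |Ch(K)_v^w| is the subset (realization chain_le (Ch v w)) of this space.   *)
Definition Ch_space (R : realType) v w : topologicalType :=
  realization_space R chain_le (Ch v w).

(* This is g_s, as a singular chain, when n is the dimension of s.            *)
Definition generator_chain (R : realType) v w (n : nat) (s : seq K) :
    chain R (Ch_space R v w) n :=
  \sum_(sigma : 'S_(sumn (chain_type s)) | block_perm sigma)
  \sum_(tau | @T_n (chain_type s) n tau)
    << (-1) ^+ sigma * sgn_n tau *g
       affine_simplex (fun j : 'I_n.+1 =>
         I_chain s (fun i => f_tau tau j (perm_nat sigma i))) >>.

Section Cellular.
Variables (R : realType) (v w : K) (n : nat).

Definition skeleton : set (Ch_space R v w) :=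
  realization chain_le (Ch_le v w n).
Definition skeleton_lt : set (Ch_space R v w) :=
  realization chain_le (Ch_lt v w n).

Definition cellular : zmodType := homology R n skeleton skeleton_lt.

Definition generator_class (s : seq K) : cellular :=
  homology_class skeleton skeleton_lt (generator_chain R v w n s).

End Cellular.
Arguments skeleton : clear implicits.
Arguments skeleton_lt : clear implicits.

Lemma skeleton_lt_sub (R : realType) v w n :
  skeleton_lt R v w n `<=` skeleton R v w n.-1.
Proof.
move=> p [m [x [[xP x_le] xp]]]; exists m, x; split=> //; split=> // i.
have [xC xn] := xP i; split=> //; move: xn; rewrite /=.
by move=> xn; rewrite -ltnS prednK // (leq_ltn_trans _ xn).
Qed.

(* For n = 0 this is the zero map, with an immaterial codomain. *)
Definition cellular_diff (R : realType) v w n :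
    cellular R v w n -> cellular R v w n.-1 :=
  connecting_map (skeleton_lt R v w n.-1) (@skeleton_lt_sub R v w n).

End Precubical.

(* The elements i of A stand for the numbers i + 1. *)
Definition sgn_set (m : nat) (A : {set 'I_m}) : int :=
  if \sum_(i in A) i.+1 == \sum_(1 <= i < #|A|.+1) i %[mod 2]%N then 1 else -1.

(* Main.v *)
Require Import Defs.
From mathcomp Require Import all_boot all_order all_algebra.
From mathcomp Require Import all_classical all_reals all_analysis.
From mathcomp Require Import perm generic_quotient ring_quotient freeg zify.
From Stdlib Require Import Relation_Operators.

(* The identity already holds for singular chains. Identify tau with the       *)
(* permutation p of {1, ..., n} that lists its values off the breaks. In the   *)
(* boundary of the sum over (sigma, p), the faces omitting f_i with 0 < i < n  *)
(* cancel under exchanging the values i and i + 1 of p, and those omitting f_0 *)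
(* cancel under multiplying sigma by the transposition of the two positions    *)
(* merged in f_1. In the faces omitting f_n, the place where p attains its     *)
(* maximum cuts some block k into pieces of sizes r and n_k - r, and sigma     *)
(* sends a set A of size r into the first piece; sigma is then uniquely the    *)
(* product of the shuffle that sorts A to the front and of a permutation for   *)
(* the refined type, so these faces are the simplices of g_(d_(k,A) c). The    *)
(* sign of the shuffle is sgn(A) and removing the maximum from p gives the     *)
(* other sign.                                                                 *)

Set Implicit Arguments.
Unset Strict Implicit.
Unset Printing Implicit Defensive.
Import GRing.Theory Num.Theory numFieldNormedType.Exports.

Local Open Scope nat_scope.

(** * Permutations acting on natural numbers *)

(** The map [cellular_diff] sends the class of a relative cycle to the class of its singular
    boundary ([connecting_class]). So the formula follows from an identity of chains,
    [boundary_gen], once the generators are known to be relative cycles ([gen_relative_cycle]),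
    which is itself a consequence of that identity.

    For the computation, the functions tau become permutations p ([sum_T_n]), and I_c(f sigma)
    becomes [refine], a description by words of face maps ([I_chain_refine]); [generator_chainE]
    then rewrites g_c as [gen]. Faces omitting an inner vertex or the least one cancel in pairs
    ([face_term_inner], [face_term0]). In the faces omitting the greatest vertex, p is sorted by the
    place of its maximum ([sum_lift_perm], [sum_gaps]) and sigma by cosets of the block permutations
    of the finer type ([sum_split_block]). [vertices_subdivide] identifies these faces with the
    simplices of the subdivided chain: on functions by [height_lift], on cubes by [refine_split].
    The coefficient is found in [face_term_last], from [shuffle_exists] and the sign of
    [lift_perm]. *)

Section PermutationsOfNat.
Variable N : nat.
Implicit Types s t : 'S_N.

(** Positions stay natural numbers, so that bounds can be left to [lia]. The body is that of
    [perm_nat], and the two are convertible. *)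
Definition nperm s (i : nat) : nat := if insub i is Some i' then s i' else i.

Lemma npermE s (i : 'I_N) : nperm s i = s i.
Proof. by rewrite /nperm insubT //= => lt_iN; congr (val (s _)); apply: val_inj. Qed.

Lemma nperm_out s i : N <= i -> nperm s i = i.
Proof. by move=> leNi; rewrite /nperm insubF // ltnNge leNi. Qed.

Lemma ltn_nperm s i : i < N -> nperm s i < N.
Proof. by move=> iN; rewrite (npermE s (Ordinal iN)). Qed.

Lemma nperm1 i : nperm 1 i = i.
Proof.
by case: (ltnP i N) => [iN|/nperm_out//]; rewrite (npermE 1 (Ordinal iN)) perm1.
Qed.

Lemma nperm_mul s t i : nperm (s * t) i = nperm t (nperm s i).
Proof.
case: (ltnP i N) => [iN|Ni]; last by rewrite !nperm_out.
by rewrite (npermE s (Ordinal iN)) (npermE (s * t) (Ordinal iN)) npermE permM.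
Qed.

Lemma npermK s : cancel (nperm s) (nperm s^-1).
Proof. by move=> i; rewrite -nperm_mul mulgV nperm1. Qed.

Lemma npermKV s : cancel (nperm s^-1) (nperm s).
Proof. by move=> i; rewrite -nperm_mul mulVg nperm1. Qed.

Lemma nperm_tperm (x y : 'I_N) i :
  nperm (tperm x y) i = if i == x then y : nat else if i == y then x : nat else i.
Proof.
case: (ltnP i N) => [iN|Ni].
  rewrite (npermE _ (Ordinal iN)) permE /=.
  by rewrite -!val_eqE /=; do 2?case: ifP.
by rewrite nperm_out // !gtn_eqF ?(leq_trans _ Ni).
Qed.

End PermutationsOfNat.

Lemma nperm_lift n (q : 'I_n.+1) (p : 'S_n) i : i < n.+1 -> i != q ->
  nperm (lift_perm q ord_max p) i = nperm p (unbump q i).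
Proof.
move=> lt_in iq; rewrite (npermE _ (Ordinal lt_in)).
case: (unliftP q (Ordinal lt_in)) => [j|] E; last first.
  by case/eqP: iq; exact: (congr1 val E).
rewrite E lift_perm_lift (congr1 val E : i = bump q j).
by rewrite bumpK npermE /= /bump leqNgt ltn_ord.
Qed.

Lemma nperm_lift_id n (q : 'I_n.+1) (p : 'S_n) : nperm (lift_perm q ord_max p) q = n.
Proof. by rewrite npermE lift_perm_id. Qed.

(* Multiplication by an odd permutation exchanges even and odd terms. *)
Lemma sum_odd_perm0 (V : zmodType) N (P : pred 'S_N) (F : 'S_N -> V) (t : 'S_N) :
  odd_perm t -> (forall s, P (s * t)%g = P s) ->
  (forall s, F (s * t)%g = - F s)%R -> (\sum_(s | P s) F s = 0)%R.
Proof.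
move=> t_odd Pt Ft; rewrite (bigID (@odd_perm _)) /=.
rewrite [X in (_ + X)%R](reindex_inj (mulIg t)) /=.
rewrite [X in (_ + X)%R](eq_bigl (fun s => P s && odd_perm s)); last first.
  by move=> s; rewrite Pt odd_permM t_odd addbT negbK.
by rewrite -big_split big1 // => s _; rewrite /= Ft addrN.
Qed.

(** * Block indices and ranks of gaps *)

Section Staircases.

(** Block-index functions and counting functions both have this shape. As b i is the number of jumps
    below i, [i - b i] is the number of places below i where b is constant. *)
Definition staircase (b : nat -> nat) :=
  b 0 = 0 /\ forall i, b i <= b i.+1 <= (b i).+1.

Variable b : nat -> nat.
Hypothesis b_stair : staircase b.

Lemma staircase_mono : {homo b : i j / i <= j}.
Proof.
by apply: homo_leq => [//|? ? ?|i]; [exact: leq_trans | case/andP: (b_stair.2 i)].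
Qed.

Lemma staircase_leq i : b i <= i.
Proof.
elim: i => [|i IH]; first by rewrite b_stair.1.
by have := b_stair.2 i; lia.
Qed.

Lemma rank_mono : {homo (fun i => i - b i) : i j / i <= j}.
Proof.
apply: homo_leq => [//|? ? ?|i]; first exact: leq_trans.
by have := b_stair.2 i; have := staircase_leq i; lia.
Qed.

Lemma rank_step i : b i = b i.+1 -> i.+1 - b i.+1 = (i - b i).+1.
Proof. by have := staircase_leq i; lia. Qed.

Lemma rank_onto N q : q < N - b N ->
  exists x, [/\ x < N, b x = b x.+1 & x - b x = q].
Proof.
elim: N => [|N IH]; first by rewrite sub0n.
have := b_stair.2 N; have := staircase_leq N => leN /andP [le1 le2] ltq.
have [/IH [x [xN bx rx]]|] := ltnP q (N - b N); first by exists x; split=> //; lia.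
by exists N; split; lia.
Qed.

Lemma rank_lt N i : i < N -> b i = b i.+1 -> i - b i < N - b N.
Proof. by move=> iN bi; rewrite -(rank_step bi) rank_mono. Qed.

End Staircases.

Lemma reshape_index_cons m t i :
  reshape_index (m :: t) i =
  if i < m then 0 else (reshape_index t (i - m)).+1.
Proof.
rewrite /reshape_index /= subn_eq0.
by case: ltnP => // le_mi; rewrite subSn.
Qed.

Lemma reshape_index_out t i : sumn t <= i -> reshape_index t i = size t.
Proof.
elim: t i => //= m t IH i le_i; rewrite reshape_index_cons IH; last by lia.
by case: ltnP => //; lia.
Qed.

Lemma reshape_index_stair t : all (ltn 0) t -> staircase (reshape_index t).
Proof.
move=> t0; split.
  by case: t t0 => //= m t /andP [m0 _]; rewrite reshape_index_cons m0.
elim: t t0 => //= m t IH /andP [m0 t0] i; rewrite !reshape_index_cons.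
have [lt_im|le_mi] := ltnP i m; last first.
  by rewrite [i.+1 < m]ltnNge (leqW le_mi) /= subSn // !ltnS; exact: IH.
case: ltnP => // le_mi1; have -> : i.+1 - m = 0 by lia.
by case: t t0 {IH} => //= m' t /andP [m'0 _]; rewrite reshape_index_cons m'0.
Qed.

Lemma reshape_index_mid t1 m t2 y : all (ltn 0) t1 ->
  (reshape_index (t1 ++ m :: t2) y == size t1) =
  (sumn t1 <= y < sumn t1 + m).
Proof.
elim: t1 y => [|m' t1 IH] y /=; first by rewrite reshape_index_cons; case: ltnP.
case/andP => m'0 t10; rewrite reshape_index_cons.
by case: ltnP => ym'; [lia | rewrite eqSS IH //; lia].
Qed.

Lemma reshape_index_split t1 r m t2 y : r <= m ->
  reshape_index (t1 ++ r :: (m - r) :: t2) y =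
  reshape_index (t1 ++ m :: t2) y + (sumn t1 + r <= y).
Proof.
move=> rm; elim: t1 y => [|m' t1 IH] y /=; rewrite !reshape_index_cons.
  case: (ltnP y r) => yr.
    by rewrite (leq_trans yr rm).
  have -> : (y - r < m - r) = (y < m) by lia.
  case: ltnP => ym; first by lia.
  by rewrite -subnDA subnKC //; lia.
rewrite IH; case: ltnP => ym'; first by rewrite [X in _ = X]add0n; lia.
by rewrite addSn; congr (_ + nat_of_bool _).+1; lia.
Qed.

(* For the block-index function b of a type, step b p j i says that the gap    *)
(* between the positions i and i + 1 separates two values of f_j^tau; i - b i  *)
(* is the rank of this gap among those that are not breaks of the type.        *)
Section Heights.
Variable b : nat -> nat.

Definition step n (p : 'S_n) j i := (b i != b i.+1) || (j <= nperm p (i - b i)).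
Definition height n (p : 'S_n) j i := (\sum_(i' < i) step p j i').+1.

Lemma heightS n (p : 'S_n) j i : height p j i.+1 = height p j i + step p j i.
Proof. by rewrite /height big_ord_recr. Qed.

Lemma height_mono n (p : 'S_n) j : {homo height p j : i k / i <= k}.
Proof.
by apply: homo_leq => [//|? ? ?|i]; [exact: leq_trans | rewrite heightS leq_addr].
Qed.

Lemma height_step n (p : 'S_n) j i :
  height p j i <= height p j i.+1 <= (height p j i).+1.
Proof. by rewrite heightS; case: step; rewrite ?addn1 ?addn0 leqnn ?leqnSn. Qed.

Lemma height_last n (p : 'S_n) : staircase b -> forall N, N - b N = n ->
  forall i, i <= N -> height p n i = (b i).+1.
Proof.
move=> b_st N rN i iN; congr _.+1.
elim: i iN => [|i IH] iN; first by rewrite big_ord0 b_st.1.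
rewrite big_ord_recr /= IH ?(ltnW iN) // /step.
have := b_st.2 i.
case: eqP => [bi|] /=; last by lia.
have : nperm p (i - b i) < n by rewrite ltn_nperm // -[ltnRHS]rN; exact: rank_lt.
by lia.
Qed.

End Heights.

Section LiftedHeights.
Variables (b c : nat -> nat) (N n x : nat) (q : 'I_n.+1) (p : 'S_n).
Hypotheses (b_stair : staircase b) (b_rank : N - b N = n.+1).
Hypotheses (xN : x < N) (bx : b x = b x.+1) (xq : x - b x = q).
Hypothesis cE : forall i, c i = b i + (x < i).

(** The maximum n of the lifted permutation meets every threshold j <= n, so the gap x always
    separates values and may count as a break. The other gaps keep their values of p; ranks beyond x
    drop by one. *)
Lemma step_lift j i : j <= n -> i < N ->
  step b (lift_perm q ord_max p) j i = step c p j i.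
Proof.
move=> jn iN; rewrite /step !cE.
have [->|ix] := eqVneq i x.
  by rewrite xq nperm_lift_id jn orbT; case: eqP => //; lia.
have -> : (b i + (x < i) != b i.+1 + (x < i.+1)) = (b i != b i.+1).
  by rewrite ltnS; case: eqP; case: eqP; lia.
case: eqP => [bi|] //=.
have iq : (q < i - b i) = (x < i).
  rewrite -xq; apply/idP/idP => [|lt_xi].
    by apply: contraTT; rewrite -!leqNgt; exact: rank_mono.
  by rewrite -rank_step //; exact: rank_mono.
have lt_rn : i - b i < n.+1 by rewrite -b_rank rank_lt.
have ri_q : i - b i != q.
  apply/eqP => e; have lt_ix : i < x by move: iq; rewrite e ltnn; lia.
  have : i.+1 - b i.+1 <= x - b x by exact: rank_mono.
  by rewrite rank_step // e xq ltnn.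
by rewrite nperm_lift // /unbump iq subnDA subnAC.
Qed.

Lemma height_lift j i : j <= n -> i <= N ->
  height b (lift_perm q ord_max p) j i = height c p j i.
Proof.
move=> jn iN; congr _.+1; apply: eq_bigr => k _.
by rewrite step_lift // (leq_trans _ iN).
Qed.

End LiftedHeights.

(** Only the threshold j = w tells the values v and w = v + 1 apart. *)
Lemma height_swap b n (p : 'S_n) (v w : 'I_n) j i : w = v.+1 :> nat ->
  j != w :> nat -> height b (p * tperm v w) j i = height b p j i.
Proof.
move=> vw jw; congr _.+1; apply: eq_bigr => x _; congr (nat_of_bool (_ || _)).
rewrite nperm_mul nperm_tperm; move: (nperm p _) => y.
by move: jw; rewrite vw; do 2?case: ifP => [/eqP ->|_]; lia.
Qed.

(** The least value of p meets no threshold but 0. *)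
Lemma height_flat b n (p : 'S_n) j x : b x = b x.+1 -> nperm p (x - b x) = 0 ->
  0 < j -> height b p j x.+1 = height b p j x.
Proof. by move=> bx px j0; rewrite heightS /step bx eqxx -bx px leqNgt j0 addn0. Qed.

(** * Shuffles and their signs *)

Section Shuffles.
Implicit Type a : nat -> bool.

Let cnt a i := count a (iota 0 i).
Let wt a i := \sum_(k < i) a k * k.

Lemma count_iotaS a i : count a (iota 0 i.+1) = count a (iota 0 i) + a i.
Proof. by rewrite -addn1 iotaD count_cat /= add0n addn0. Qed.

Let wtS a i : wt a i.+1 = wt a i + a i * i.
Proof. by rewrite /wt big_ord_recr. Qed.

Variables (N o m : nat).
Hypothesis om : o + m <= N.

(* The permutation of the block [o, o + m) that moves the positions selected   *)
(* by a to its beginning, keeping the order otherwise.                         *)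
Definition is_shuffle a (rho : 'S_N) :=
  (forall y, ~~ (o <= y < o + m) -> nperm rho y = y) /\
  (forall i, i < m -> nperm rho (o + i) = o +
     (if a i then count a (iota 0 i)
      else count a (iota 0 m) + (i - count a (iota 0 i)))).

(** Induction on the sum of the selected positions. Where a selected position directly follows an
    unselected one, exchanging the two lowers the sum by one and multiplies the shuffle by a
    transposition. Where this never occurs, the selected positions form an initial segment and the
    identity serves. *)
Lemma shuffle_exists a : exists2 rho : 'S_N, is_shuffle a rho &
  odd_perm rho = odd (\sum_(i < m) a i * i + \sum_(i < count a (iota 0 m)) i).
Proof.
rewrite -/(wt a m) -/(cnt a m).
have [k] := ubnP (wt a m); elim: k a => // k IH a le_wk.
have [/existsP [j /and3P [jm aj aj1]]|] :=
  boolP [exists j : 'I_m, [&& j.+1 < m, ~~ a j & a j.+1]]; last first.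
  rewrite negb_exists => /forallP aD.
  have aP i : i.+1 < m -> a i.+1 -> a i.
    move=> im ai; have im' := ltnW im.
    by have := aD (Ordinal im'); rewrite /= im ai andbT negbK.
  have cntE i : (i < m -> a i -> cnt a i = i) /\
      (i < m -> ~~ a i -> cnt a m = cnt a i).
    split.
      elim: i => // i IHi im ai; rewrite /cnt count_iotaS -/(cnt a i).
      by have ai' := aP _ im ai; rewrite IHi ?ai' ?addn1 // ltnW.
    move=> im' ai.
    have cd d : i + d < m -> cnt a (i + d).+1 = cnt a i /\ ~~ a (i + d).
      elim: d => [|d IHd]; first by rewrite addn0 /cnt count_iotaS (negPf ai) addn0.
      rewrite addnS => idm; have [ca na] := IHd (ltnW idm).
      have na' : ~~ a (i + d).+1 by apply: contra na; exact: aP.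
      by rewrite /cnt count_iotaS -/(cnt _ _) ca (negPf na') addn0.
    have [|ca _] := cd (m.-1 - i); first by lia.
    by rewrite -ca; congr (cnt a _); lia.
  have wtE i : i <= m -> wt a i = \sum_(l < cnt a i) l.
    elim: i => [|i IHi] im; first by rewrite /wt !big_ord0.
    rewrite wtS IHi 1?ltnW // /cnt count_iotaS -/(cnt _ _).
    have [c1 c2] := cntE i.
    case ai: (a i); last by rewrite !addn0.
    by rewrite (c1 im ai) addn1 big_ord_recr mul1n.
  exists 1%g; last by rewrite odd_perm1 wtE // addnn odd_double.
  split=> [y _|i im]; rewrite nperm1 //; congr (_ + _).
  have [c1 c2] := cntE i; rewrite -/(cnt a i) -/(cnt a m).
  case: ifP => ai; first by rewrite c1.
  rewrite c2 ?ai // subnKC //.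
  by rewrite /cnt (leq_trans (count_size _ _)) // size_iota.
pose sw i := if i == j :> nat then j.+1 else if i == j.+1 then j : nat else i.
pose a' := a \o sw.
have a'E i : a' i = if i == j :> nat then true else
    if i == j.+1 then false else a i.
  by rewrite /a' /= /sw; case: eqP => // _; case: eqP => // _; exact: negPf.
have cntE i : cnt a' i = cnt a i + (i == j.+1).
  elim: i => // i IHi; rewrite /cnt !count_iotaS -!/(cnt _ _) IHi a'E eqSS.
  case: (eqVneq i j) => [->|ij]; first by rewrite (negPf aj) ltn_eqF // addn0.
  case: (eqVneq i j.+1) => [->|ij1]; first by rewrite aj1 !addn0.
  by rewrite !addn0.
(* A prefix of length j + 1 contains only one of the two exchanged positions, whence the term with
   [i == j.+1]. *)
have wtE i : wt a' i + (j.+1 < i) = wt a i + (i == j.+1) * j.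
  elim: i => [|i IHi]; first by rewrite /wt !big_ord0.
  rewrite !wtS a'E eqSS ltnS.
  case: (eqVneq i j) IHi => [->|ij].
    by rewrite (negPf aj) ltnn ltnNge leqnSn /= (ltn_eqF (ltnSn j)); lia.
  case: (eqVneq i j.+1) => [->|ij1]; first by rewrite aj1 ltnn leqnn; lia.
  by rewrite (_ : (j < i) = (j.+1 < i)); lia.
have [|rho [rho_out rho_in] rho_odd] := IH a'.
  by have := wtE m; rewrite jm gtn_eqF // addn0 addn1 => e; rewrite -ltnS e.
have jN : o + j < N by lia.
have j1N : o + j.+1 < N by lia.
exists (tperm (Ordinal jN) (Ordinal j1N) * rho)%g; last first.
  rewrite odd_permM odd_tperm rho_odd cntE gtn_eqF // addn0.
  have := wtE m; rewrite jm gtn_eqF // mul0n addn0 => <-.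
  by rewrite -val_eqE /= eqn_add2l ltn_eqF // !oddD addbT addTb addNb.
split=> [y yo|i im]; rewrite nperm_mul nperm_tperm /=.
  by rewrite !ifF ?rho_out //; apply/eqP; lia.
rewrite !eqn_add2l.
have -> : (if i == j then o + j.+1 else if i == j.+1 then o + j else o + i) =
    o + sw i by rewrite /sw; do 2?case: ifP.
have sw_m : sw i < m by rewrite /sw; do 2?case: ifP => // _; lia.
rewrite rho_in // -!/(cnt _ _) !cntE (gtn_eqF jm) addn0.
have -> : a' (sw i) = a i.
  rewrite a'E /sw; case: (eqVneq i j) => [->|ij].
    by rewrite gtn_eqF // eqxx (negPf aj).
  by case: (eqVneq i j.+1) => [->|ij1]; rewrite ?eqxx ?aj1 // (negPf ij) (negPf ij1).
rewrite /sw; case: (eqVneq i j) => [->|ij].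
  rewrite (negPf aj) eqxx /cnt count_iotaS (negPf aj) addn0.
  by rewrite addn1 subSS.
case: (eqVneq i j.+1) => [->|ij1]; last by rewrite (negPf ij1) addn0.
by rewrite aj1 ltn_eqF // addn0 /cnt count_iotaS (negPf aj) addn0.
Qed.

End Shuffles.

Definition mem_nat m (A : {set 'I_m}) (i : nat) : bool :=
  if insub i is Some j then j \in A else false.

Lemma mem_natE m (A : {set 'I_m}) (i : 'I_m) : mem_nat A i = (i \in A).
Proof.
by rewrite /mem_nat insubT //= => lt_im; congr (_ \in A); apply: val_inj.
Qed.

Lemma count_mem_nat m (A : {set 'I_m}) : count (mem_nat A) (iota 0 m) = #|A|.
Proof.
rewrite -sum1_count -sum1_card -{1}[m]subn0 big_mkord.
by apply: eq_bigl => i; rewrite mem_natE.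
Qed.

Lemma count_staircase a : staircase (fun i => count a (iota 0 i)).
Proof. by split=> // i; rewrite count_iotaS; case: (a i); lia. Qed.

(** * Cosets of the permutations respecting a split block *)

Definition block_inv N (b : nat -> nat) (s : 'S_N) :=
  [forall i : 'I_N, b (s i) == b i].

Lemma block_invP N (b : nat -> nat) (s : 'S_N) :
  reflect (forall i, i < N -> b (nperm s i) = b i) (block_inv b s).
Proof.
apply: (iffP forallP) => [sb i iN|sb i].
  by rewrite (npermE s (Ordinal iN)); apply/eqP; exact: (sb (Ordinal iN)).
by rewrite -npermE sb.
Qed.

Section SplitBlock.
Variables (b c : nat -> nat) (N o m r k : nat).
Hypotheses (om : o + m <= N) (rm : r < m).
Hypotheses (b_mono : {homo b : i j / i <= j}).
Hypotheses (bk : forall y, (b y == k) = (o <= y < o + m)).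
Hypothesis cE : forall y, c y = b y + (o + r <= y).

Lemma block_cases y :
  [|| (y < o) && (b y < k), (o <= y < o + m) && (b y == k)
    | (o + m <= y) && (k < b y)].
Proof.
have bo : b o = k by apply/eqP; rewrite bk; lia.
have := bk y; case: (ltngtP (b y) k) => [by_lt|by_gt|_]; last by lia.
  case: (leqP o y) => [oy|]; last by lia.
  by have := b_mono oy; lia.
case: (leqP y o) => [oy|]; last by lia.
by have := b_mono oy; lia.
Qed.

Lemma shuffle_in a (rho : 'S_N) i : is_shuffle o m a rho -> i < m ->
  count a (iota 0 m) = r ->
  o <= nperm rho (o + i) < o + m /\ (nperm rho (o + i) < o + r) = a i.
Proof.
move=> [_ rho_in] im ar; rewrite rho_in //.
have cs := count_staircase a.
have : count a (iota 0 i.+1) <= count a (iota 0 m) := staircase_mono cs im.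
have : i.+1 - count a (iota 0 i.+1) <= m - count a (iota 0 m) := rank_mono cs im.
have : count a (iota 0 i) <= i := staircase_leq cs i.
by rewrite count_iotaS ar; case: (a i); lia.
Qed.

Lemma shuffle_block a (rho : 'S_N) y : is_shuffle o m a rho ->
  count a (iota 0 m) = r -> b (nperm rho y) = b y.
Proof.
move=> rhoP ar; case oy: (o <= y < o + m); last first.
  by rewrite rhoP.1 // oy.
have [|y_in _] := shuffle_in (i := y - o) rhoP _ ar; first by lia.
rewrite subnKC in y_in; last by lia.
by move: oy; rewrite -bk => /eqP ->; apply/eqP; rewrite bk.
Qed.

Definition first_part (s : 'S_N) : {set 'I_m} :=
  [set i : 'I_m | nperm s (o + i) < o + r].

(** Here [c] cuts block k of [b], the interval [o, o + m), after r positions. As [rho] keeps the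
    blocks and brings A to those r positions, s respects the pieces exactly when [rho * s], which
    applies [rho] first, respects the blocks and sends precisely A there. *)
Lemma block_inv_split (rho s : 'S_N) (A : {set 'I_m}) :
  is_shuffle o m (mem_nat A) rho -> #|A| = r ->
  block_inv c s = block_inv b (rho * s) && (first_part (rho * s) == A).
Proof.
move=> rhoP Ar; have cr := etrans (count_mem_nat A) Ar.
have bE := shuffle_block _ rhoP cr.
have key y : c (nperm s (nperm rho y)) = c (nperm rho y) <->
    b (nperm (rho * s) y) = b y /\ forall i, i < m -> y = o + i ->
      (nperm (rho * s) y < o + r) = mem_nat A i.
  rewrite nperm_mul !cE bE.
  have := block_cases (nperm s (nperm rho y)); have := block_cases y.
  case oy: (o <= y < o + m); last first.
    rewrite (rhoP.1 y) ?oy //; move: (nperm s y) => z bz.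
    by split=> [|[]]; [split|]; lia.
  have im : y - o < m by lia.
  have [] := shuffle_in rhoP im cr; rewrite subnKC; last by lia.
  move: (nperm rho y) => y'; move: (nperm s y') => z y'_in y'_a hy hz.
  split=> [e|[e /(_ _ im)]]; last first.
    by rewrite subnKC; [move=> /(_ erefl) | idtac]; lia.
  split=> [|i _ yi]; first by lia.
  have -> : i = y - o by lia.
  by rewrite -y'_a; lia.
apply/block_invP/andP => [sP|[/block_invP sP /eqP sA] y yN].
  split.
    apply/block_invP => y yN.
    by have [] := (key y).1 (sP _ (ltn_nperm rho yN)).
  apply/eqP/setP => i; rewrite inE -mem_natE.
  have oi : o + i < N by apply: leq_trans om; rewrite ltn_add2l.
  by have [_ /(_ i (ltn_ord i) erefl)] := (key (o + i)).1 (sP _ (ltn_nperm rho oi)).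
rewrite -(npermKV rho y); apply/key; split=> [|i im yi].
  by apply: sP; exact: ltn_nperm.
by rewrite yi -[i]/(nat_of_ord (Ordinal im)) -sA mem_natE inE.
Qed.

(** The inverse of s maps the first r positions of the block bijectively onto this set. *)
Lemma card_first_part (s : 'S_N) : block_inv b s -> #|first_part s| = r.
Proof.
move=> sb; have {}sb : block_inv b s^-1%g.
  apply/block_invP => y yN; rewrite -{2}(npermKV s y).
  by rewrite (block_invP _ _ sb) // ltn_nperm.
have in_block (i : 'I_r) : o <= nperm s^-1 (o + i) < o + m.
  rewrite -bk (block_invP _ _ sb) ?bk; have := ltn_ord i; lia.
have lt_m (i : 'I_r) : nperm s^-1 (o + i) - o < m by have := in_block i; lia.
pose f (i : 'I_r) := Ordinal (lt_m i).
have f_inj : injective f.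
  move=> i j /(congr1 val) /= ij; apply: val_inj; apply: (@addnI o).
  apply: (can_inj (npermKV s)) => /=; have := in_block i; have := in_block j; lia.
rewrite -[r in RHS]card_ord -(card_imset _ f_inj) -cardsE; apply: eq_card => i.
rewrite !inE; apply/idP/imsetP => [ir|[j _ ->]]; last first.
  by rewrite /= subnKC ?npermKV ?ltn_add2l //; case/andP: (in_block j).
have io : o <= nperm s (o + i).
  have : o + i < N by apply: leq_trans om; rewrite ltn_add2l.
  move/(ltn_nperm s)/(block_invP _ _ sb)/eqP; rewrite npermK eq_sym.
  have -> : b (o + i) = k by apply/eqP; rewrite bk; have := ltn_ord i; lia.
  by rewrite bk => /andP [].
have jr : nperm s (o + i) - o < r by lia.
by exists (Ordinal jr) => //; apply: val_inj; rewrite /= subnKC // npermK addKn.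
Qed.

(** The [rho A] with [#|A| = r] represent the cosets of the permutations respecting [c] among those
    respecting [b]; the coset of s is read off from [first_part s]. *)
Lemma sum_split_block (V : zmodType) (rho : {set 'I_m} -> 'S_N) (F : 'S_N -> V) :
  (forall A, is_shuffle o m (mem_nat A) (rho A)) ->
  (\sum_(s | block_inv b s) F s =
   \sum_(A : {set 'I_m} | #|A| == r) \sum_(s | block_inv c s) F (rho A * s)%g)%R.
Proof.
move=> rhoP; rewrite (partition_big first_part (fun A => #|A| == r)) /=; last first.
  by move=> s /card_first_part ->.
apply: eq_bigr => A /eqP Ar; rewrite (reindex_inj (mulgI (rho A))).
by apply: eq_bigl => s; rewrite (block_inv_split s (rhoP A) Ar).
Qed.

End SplitBlock.

(** The gap with rank q is the cut after r positions of block k. From its position one subtracts the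
    k breaks before it, and 1 because positions are counted from 0. *)
Lemma sum_gaps (V : zmodType) t (G : nat -> V) : all (ltn 0) t ->
  (\sum_(q < sumn t - size t) G q =
   \sum_(k < size t) \sum_(1 <= r < nth 0 t k) G (sumn (take k t) + r - k.+1)%N)%R.
Proof.
elim: t G => [|m t IH] G /=; first by rewrite !big_ord0.
case/andP => m0 t0; have tl : size t <= sumn t.
  by elim: t t0 {IH} => //= m' t IH /andP [m'0 /IH]; lia.
rewrite big_ord_recl /= -(big_mkord xpredT G).
rewrite (@big_cat_nat _ _ _ m.-1) /=; [|by []|lia].
congr (_ + _)%R.
  rewrite big_add1; apply: eq_big_nat => r rm; congr G; lia.
rewrite -{1}[m.-1]add0n big_addn.
rewrite (_ : m + sumn t - (size t).+1 - m.-1 = sumn t - size t); last by lia.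
rewrite big_mkord (IH (fun q => G (q + m.-1))) //; apply: eq_bigr => k _.
apply: eq_big_nat => r rm; congr G; rewrite /bump /=.
have : k <= sumn (take k t).
  have : all (ltn 0) (take k t) by apply/allP => x /mem_take; exact: (allP t0).
  have sk : size (take k t) = k by rewrite size_take ltn_ord.
  rewrite -[X in X <= _]sk; move: (take k t) {sk}.
  by elim=> //= m' t' IH' /andP [m'0 /IH']; lia.
by rewrite add0n; lia.
Qed.

(** Counting from 1 instead of 0 adds [#|A|] to both sums, so sgn(A) is given by the parity found in
    [shuffle_exists]. *)
Lemma sgn_set_odd m (A : {set 'I_m}) :
  sgn_set A = ((-1) ^+ odd (\sum_(i < m) mem_nat A i * i + \sum_(i < #|A|) i))%R.
Proof.
rewrite /sgn_set big_add1 big_mkord.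
under eq_bigr do rewrite -addn1.
under [X in _ == X %[mod _]]eq_bigr do rewrite -addn1.
rewrite !big_split /= !sum_nat_const card_ord eqn_modDr.
have -> : \sum_(i in A) i = \sum_(i < m) mem_nat A i * i.
  rewrite big_mkcond; apply: eq_bigr => i _.
  by rewrite mem_natE; case: ifP; rewrite ?mul1n.
by rewrite !modn2 oddD; do 2!case: odd.
Qed.

(** * Iterated faces *)

Section Faces.
Variable K : precubical.
Implicit Types (c : K) (k : nat) (f g l : seq (option bool)).

(** The first letter of the word is applied last, as in d_1 ... d_n. *)
Fixpoint faces k l c : K :=
  if l is x :: l' then
    if x is Some e then face e k (faces k.+1 l' c) else faces k.+1 l' c
  else c.

(** The word of a composite face ([faces_fill]): the letters of g replace the stars of f in turn. *)
Fixpoint fill f g : seq (option bool) :=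
  match f with
  | [::] => [::]
  | Some e :: f' => Some e :: fill f' g
  | None :: f' => head None g :: fill f' (behead g)
  end.

Lemma size_fill f g : size (fill f g) = size f.
Proof. by elim: f g => //= -[e|] f IH g /=; rewrite IH. Qed.

Lemma nth_fill f g i : i < size f -> nth None (fill f g) i =
  if nth None f i is Some e then Some e
  else nth None g (i - count isSome (take i f)).
Proof.
elim: f g i => // -[e|] f IH g [|i] //= i_lt; rewrite ?nth0 // IH //.
case: nth => //; rewrite nth_behead add0n subSn //.
by rewrite (leq_trans (count_size _ _)) // size_take; case: ltnP.
Qed.

Lemma dim_faces k l c : k + size l <= cube_dim c ->
  cube_dim (faces k l c) = cube_dim c - count isSome l.
Proof.
elim: l k => [|x l IH] k /= kl; first by rewrite subn0.
have cl := count_size isSome l; have := IH k.+1 => /(_ ltac:(lia)).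
by case: x => [e|] //= dE; rewrite dim_face dE; lia.
Qed.

Lemma faces_face e k i l c : k <= i -> (i + size l).+1 <= cube_dim c ->
  faces i l (face e k c) = face e k (faces i.+1 l c).
Proof.
move=> ki; elim: l i ki => //= x l IH i ki il.
have dE : cube_dim (faces i.+2 l c) = cube_dim c - count isSome l.
  by apply: dim_faces; lia.
have := count_size isSome l; rewrite IH; [|lia|lia] => cl.
by case: x => // h; rewrite [RHS]faceC // dE; lia.
Qed.

Lemma faces_fill k f g c : k + size f <= cube_dim c ->
  size g = size f - count isSome f ->
  faces k g (faces k f c) = faces k (fill f g) c.
Proof.
elim: f k g => [|x f IH] k g /= kf gf; first by rewrite (size0nil gf).
have cf := count_size isSome f.
case: x gf => [e|] /= gf.
  have dE : cube_dim (faces k.+1 f c) = cube_dim c - count isSome f.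
    by apply: dim_faces; lia.
  by rewrite faces_face // ?IH //; [lia | rewrite dE; lia].
case: g gf => [|x g] /= gf; first by lia.
by case: x => [e|]; rewrite IH //=; lia.
Qed.

Lemma dfaceE c (F : nat -> option bool) :
  dface (fun i : 'I_(cube_dim c) => F i) =
  faces 0 [seq F i | i <- iota 0 (cube_dim c)] c.
Proof.
have E s k : map val s = iota k (size s) ->
    foldr (fun (i : 'I_(cube_dim c)) c' =>
      if F i is Some e then face e i c' else c') c s
    = faces k (map (fun i : 'I_(cube_dim c) => F i) s) c.
  by elim: s k => //= i s IH k [<- /IH ->].
rewrite /dface (E _ 0); first by rewrite -val_enum_ord -map_comp.
by rewrite size_enum_ord -[RHS]val_enum_ord.
Qed.

Lemma vertexE e c :
  vertex e c = faces 0 (nseq (cube_dim c) (Some e)) c.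
Proof.
rewrite /vertex (dfaceE c (fun=> Some e)); congr faces.
by elim: (cube_dim c) 0 => //= m IH k; rewrite IH.
Qed.

(** The words of d^0 on the complement of a, for e = [false], and of d^1 on a, for e = [true]. *)
Definition halving (e : bool) (a : nat -> bool) m :=
  [seq if a i == e then Some e else None | i <- iota 0 m].

Lemma count_halving e a m : count isSome (halving e a m) =
  if e then count a (iota 0 m) else m - count a (iota 0 m).
Proof.
rewrite /halving count_map; set p := preim _ _.
have pE : p =1 (if e then a else predC a).
  by rewrite /p => i; case: (e) => /=; case: (a i).
rewrite (eq_count pE); case: (e) => //.
by rewrite -{2}(size_iota 0 m) -(count_predC a) addKn.
Qed.

Lemma dface_onE e c (A : {set 'I_(cube_dim c)}) :
  dface_on e (if e then A else ~: A) = faces 0 (halving e (mem_nat A) (cube_dim c)) c.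
Proof.
rewrite /halving -dfaceE; congr dface; apply/funext => i; rewrite mem_natE.
by case: e => //; rewrite ?inE; case: (i \in A).
Qed.

(** By [faces_fill], a star at position i receives the letter of G indexed by the rank of i among
    the stars. *)
Lemma faces_halving (e : bool) a c
    (r := if e then cube_dim c - count a (iota 0 (cube_dim c))
          else count a (iota 0 (cube_dim c))) (G : nat -> option bool) :
  faces 0 [seq G i | i <- iota 0 r] (faces 0 (halving e a (cube_dim c)) c) =
  faces 0 [seq if a i == e then Some e else
     G (if e then i - count a (iota 0 i) else count a (iota 0 i))
       | i <- iota 0 (cube_dim c)] c.
Proof.
have cs : count a (iota 0 (cube_dim c)) <= cube_dim c.
  by apply: (leq_trans (count_size _ _)); rewrite size_iota.
have sc : size (halving e a (cube_dim c)) = cube_dim c by rewrite size_map size_iota.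
rewrite faces_fill ?sc //; last first.
  by rewrite count_halving size_map size_iota /r; case: (e); lia.
congr faces; apply: (@eq_from_nth _ None).
  by rewrite size_fill size_map size_map !size_iota.
move=> i; rewrite size_fill sc => im; rewrite nth_fill ?sc //.
have nth_i T (d : T) (H : nat -> T) q : i < q ->
    nth d [seq H k | k <- iota 0 q] i = H i.
  by move=> iq; rewrite (nth_map 0) ?size_iota // nth_iota.
rewrite [RHS]nth_i // [nth _ (halving _ _ _) _]nth_i //.
case: ifP => // ai.
rewrite -map_take take_iota (minn_idPl (ltnW im)) -/(halving e a i).
have si : count a (iota 0 i) <= i.
  by apply: (leq_trans (count_size _ _)); rewrite size_iota.
have -> : i - count isSome (halving e a i) =
    if e then i - count a (iota 0 i) else count a (iota 0 i).
  by rewrite count_halving; case: (e); lia.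
rewrite (nth_map 0) ?size_iota ?nth_iota // /r.
all: have := staircase_mono (count_staircase a) im.
all: have := rank_mono (count_staircase a) im.
all: rewrite !count_iotaS; case: (e) ai; case: (a i) => //; lia.
Qed.

End Faces.

(** * Refinements of cube chains *)

Section CubeChains.
Variable K : precubical.
Implicit Types (c v w : K) (s : seq K).

Lemma dim_halving e (a : nat -> bool) c :
  cube_dim (faces 0 (halving e a (cube_dim c)) c) =
  if e then cube_dim c - count a (iota 0 (cube_dim c))
  else count a (iota 0 (cube_dim c)).
Proof.
rewrite dim_faces ?size_map ?size_iota // count_halving; case: e => //.
rewrite subKn //.
by apply: (leq_trans (count_size _ _)); rewrite size_iota.
Qed.

Lemma vertex_halving e h (a : nat -> bool) c : 
  vertex e (faces 0 (halving h a (cube_dim c)) c) = 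
  faces 0 [seq if a i == h then Some h else Some e | i <- iota 0 (cube_dim c)] c.
Proof.
rewrite vertexE dim_halving -(faces_halving h a c (fun=> Some e)); congr faces.
by move: (if h then _ else _) => r; elim: r 0 => //= r IH k; rewrite -IH.
Qed.

Lemma vertex_halving_same e (a : nat -> bool) c :
  vertex e (faces 0 (halving e a (cube_dim c)) c) = vertex e c.
Proof.
rewrite vertex_halving vertexE; congr faces.
by elim: (cube_dim c) 0 => //= r IH k; rewrite IH if_same.
Qed.

(** Both are the vertex of c with coordinate 1 on a and 0 elsewhere, where the two halves meet. *)
Lemma vertex_halving_mid (a : nat -> bool) c :
  vertex true (faces 0 (halving false a (cube_dim c)) c) =
  vertex false (faces 0 (halving true a (cube_dim c)) c).
Proof.
rewrite !vertex_halving; congr faces; apply: eq_map => i /=; by case: (a i).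
Qed.

Definition split_cube (a : nat -> bool) c : seq K :=
  [:: faces 0 (halving false a (cube_dim c)) c;
      faces 0 (halving true a (cube_dim c)) c].

Lemma is_cube_chain_split (a : nat -> bool) v s1 c s2 w :
  0 < count a (iota 0 (cube_dim c)) < cube_dim c ->
  is_cube_chain v (s1 ++ c :: s2) w ->
  is_cube_chain v (s1 ++ split_cube a c ++ s2) w.
Proof.
move=> ca; elim: s1 v => [|c' s1 IH] v /=; last by case/and3P => -> -> /IH ->.
rewrite !dim_halving subn_gt0 vertex_halving_mid !vertex_halving_same eqxx.
by case/and3P => _ -> ->; case/andP: ca => -> ->.
Qed.

Lemma is_cube_chain_pos v s w : is_cube_chain v s w -> all (ltn 0) (chain_type s).
Proof. by elim: s v => //= c s IH v /and3P [-> _ /IH]. Qed.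

Lemma chain_type_cat s1 s2 : chain_type (s1 ++ s2) = chain_type s1 ++ chain_type s2.
Proof. exact: map_cat. Qed.

Lemma chain_type_split (a : nat -> bool) s1 c s2
    (m := cube_dim c) (r := count a (iota 0 m)) :
  chain_type (s1 ++ split_cube a c ++ s2) =
  chain_type s1 ++ r :: (m - r) :: chain_type s2.
Proof. by rewrite chain_type_cat /= !dim_halving. Qed.

(* I_c(h) for h = f \o sigma with f non-decreasing: the cubes coming from a    *)
(* block [x, x + m) are indexed by the values f x, ..., f (x + m) - 1, so no   *)
(* normalization as in block_fun is needed.                                    *)
Fixpoint refine o s (f h : nat -> nat) : seq K :=
  if s is c :: s' then
    [seq faces 0 [seq u t (h (o + i)) | i <- iota 0 (cube_dim c)] c
       | t <- iota (f o) (f (o + cube_dim c) - f o)] ++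
    refine (o + cube_dim c) s' f h
  else [::].

Lemma refine_cat o s1 s2 f h : refine o (s1 ++ s2) f h =
  refine o s1 f h ++ refine (o + sumn (chain_type s1)) s2 f h.
Proof.
elim: s1 o => [|c s1 IH] o /=; first by rewrite addn0.
by rewrite IH catA addnA.
Qed.

Lemma eq_refine o s f h f' h' :
  (forall i, i <= sumn (chain_type s) -> f (o + i) = f' (o + i)) ->
  (forall i, i < sumn (chain_type s) -> h (o + i) = h' (o + i)) ->
  refine o s f h = refine o s f' h'.
Proof.
elim: s o => //= c s IH o ff hh.
have := ff 0 (leq0n _); rewrite addn0 => ->; rewrite ff ?leq_addr //.
congr (_ ++ _).
  apply: eq_map => t; congr faces; apply/eq_in_map => i.
  by rewrite mem_iota => /andP [_ ic]; rewrite hh // ltn_addr.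
apply: IH => i ic; rewrite -!addnA ?ff ?hh // ?leq_add2l ?ltn_add2l //.
Qed.

Lemma refine_id o s f h d :
  (forall i, i <= sumn (chain_type s) ->
     f (o + i) = d + reshape_index (chain_type s) i) ->
  (forall i, i < sumn (chain_type s) -> h (o + i) = f (o + i)) ->
  all (ltn 0) (chain_type s) -> refine o s f h = s.
Proof.
elim: s o d => //= c s IH o d fE hE /andP [c0 s0].
have f0 : f o = d by rewrite -(addn0 o) fE // reshape_index_cons c0 addn0.
have r0 : reshape_index (chain_type s) 0 = 0 by case: (reshape_index_stair s0).
have fm : f (o + cube_dim c) = d.+1.
  by rewrite fE ?leq_addr // reshape_index_cons ltnn subnn r0 addn1.
rewrite fm f0 subSnn /=; congr (_ :: _).
  rewrite (_ : map _ _ = nseq (cube_dim c) None).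
    by elim: (cube_dim c) 0 => //= r IHr k; exact: IHr.
  rewrite -[RHS](@map_id _ (nseq _ None)).
  apply: (@eq_from_nth _ None); first by rewrite !size_map size_iota size_nseq.
  move=> i; rewrite size_map size_iota => ic.
  rewrite (nth_map 0) ?size_iota // nth_iota // map_id nth_nseq ic add0n.
  rewrite hE ?fE ?reshape_index_cons ?ic ?addn0 ?ltn_addr //.
    by rewrite /u eqxx.
  by rewrite ltnW // ltn_addr.
apply: (IH _ d.+1) => // i ic; rewrite -addnA.
  rewrite fE ?leq_add2l // reshape_index_cons addKn ltnNge leq_addr /=.
  by rewrite addnS addSn.
by rewrite hE // ltn_add2l.
Qed.

(* The value f (o + r) separates the two halves of the block of c, so every    *)
(* word u t \o f is constant on one of them.                                   *)
Lemma refine_split N (a : nat -> bool) s1 c s2 (rho sig : 'S_N) f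
    (o := sumn (chain_type s1)) (m := cube_dim c) (r := count a (iota 0 m)) :
  sumn (chain_type (s1 ++ c :: s2)) <= N ->
  0 < r < m -> is_shuffle o m a rho ->
  {homo f : i j / i <= j} -> f (o + r.-1) < f (o + r) ->
  (forall y, (o <= y < o + r) -> (o <= nperm sig y < o + r)) ->
  (forall y, (o + r <= y < o + m) -> (o + r <= nperm sig y < o + m)) ->
  refine 0 (s1 ++ c :: s2) f (f \o nperm (rho * sig)%g) =
  refine 0 (s1 ++ split_cube a c ++ s2) f (f \o nperm sig).
Proof.
move=> sN rm rhoP f_mono f_lt sig1 sig2.
rewrite !refine_cat !add0n -/o /= -/m !dim_halving -/m -/r addn0 cats0.
rewrite -(addnA o r) subnKC; last by lia.
rewrite chain_type_cat sumn_cat /= -/o -/m in sN.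
rewrite !catA; congr (_ ++ _); last first.
  apply: eq_refine => // i ic /=; rewrite nperm_mul rhoP.1 //; lia.
rewrite -!catA; congr (_ ++ _).
  apply: eq_refine => // i ic /=; rewrite nperm_mul rhoP.1 //; lia.
have f1 : f o <= f (o + r) by apply: f_mono; rewrite leq_addr.
have f2 : f (o + r) <= f (o + m) by apply: f_mono; rewrite leq_add2l; lia.
have -> : f (o + m) - f o = (f (o + r) - f o) + (f (o + m) - f (o + r)) by lia.
rewrite iotaD map_cat subnKC //.
have cs := count_staircase a.
have rhoE i : i < m -> nperm (rho * sig) (o + i) =
    nperm sig (o + (if a i then count a (iota 0 i)
                    else r + (i - count a (iota 0 i)))).
  by move=> im; rewrite nperm_mul rhoP.2.
have bounds i : i < m -> if a i then count a (iota 0 i) < r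
    else r + (i - count a (iota 0 i)) < m.
  move=> im.
  have : count a (iota 0 i.+1) <= count a (iota 0 m) := staircase_mono cs im.
  have : i.+1 - count a (iota 0 i.+1) <= m - count a (iota 0 m) := rank_mono cs im.
  have : count a (iota 0 i) <= i := staircase_leq cs i.
  by rewrite count_iotaS -/r; case: (a i); lia.
congr (_ ++ _); apply/eq_in_map => t; rewrite mem_iota => t_in.
  rewrite (faces_halving false a c (fun i => u t (f (nperm sig (o + i))))).
  congr faces; apply/eq_in_map => i; rewrite mem_iota /= => im.
  rewrite rhoE //; have := bounds i im; case: (a i) => //= lt_m.
  (* On the second part f is at least f (o + r) > t, so the letters there are 0. *)
  have := sig2 (o + (r + (i - count a (iota 0 i)))) ltac:(lia).
  case/andP => /f_mono le_f _.
  have lt_t : t < f (nperm sig (o + (r + (i - count a (iota 0 i))))) by lia.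
  by rewrite /u gtn_eqF // ltnNge ltnW.
rewrite (faces_halving true a c (fun i => u t (f (nperm sig (o + r + i))))).
congr faces; apply/eq_in_map => i; rewrite mem_iota /= => im.
rewrite rhoE //; have := bounds i im; case: (a i) => //= lt_m; last by rewrite addnA.
have := sig1 (o + count a (iota 0 i)) ltac:(lia).
case/andP => _ lt_s.
(* The jump of f at o + r puts its values on the first part below t, so the letters there are 1. *)
have /f_mono le_f : nperm sig (o + count a (iota 0 i)) <= o + r.-1 by lia.
have lt_t : f (nperm sig (o + count a (iota 0 i))) < t by lia.
by rewrite /u ltn_eqF // lt_t.
Qed.

End CubeChains.

Lemma bigmin_attained (I : eqType) (l : seq I) (F : I -> nat) x i0 :
  i0 \in l -> F i0 <= x -> (forall i, i \in l -> F i0 <= F i) ->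
  \big[minn/x]_(i <- l) F i = F i0.
Proof.
move=> i0l le_x le_F; apply/eqP; rewrite eqn_leq; apply/andP; split.
  elim: l i0l {le_F} => //= i l IH; rewrite big_cons inE => /predU1P [<-|/IH].
    exact: geq_minl.
  exact/leq_trans/geq_minr.
elim: l le_F {i0l} => [|i l IH] le_F; first by rewrite big_nil.
rewrite big_cons leq_min le_F ?mem_head // IH // => k kl.
by rewrite le_F // inE kl orbT.
Qed.

(** * Comparison of [I_chain] with [refine] *)

Section RefineChain.
Variable K : precubical.
Implicit Types s : seq K.

Lemma flatten_refine c0 s o (f h : nat -> nat) (G : nat -> seq K) :
  (forall k, k < size s -> let c := nth c0 s k in
     let x := o + sumn (take k (chain_type s)) in
     G k = [seq faces 0 [seq u t (h (x + i)) | i <- iota 0 (cube_dim c)] c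
              | t <- iota (f x) (f (x + cube_dim c) - f x)]) ->
  flatten [seq G k | k <- iota 0 (size s)] = refine o s f h.
Proof.
elim: s o G => //= c s IH o G GE; rewrite (GE 0) //= addn0; congr (_ ++ _).
rewrite -[1]addn0 iotaDl -map_comp; apply: IH => k ks /=.
by rewrite GE //= addnA.
Qed.

Lemma iota_shift a n : iota a.+1 n = [seq t + a | t <- iota 1 n].
Proof. by rewrite -addn1 iotaDl; apply: eq_map => t; rewrite addnC. Qed.

(** [block_fun] subtracts the least value of h on a block and [I_cube] runs up to the greatest.
    Since sig permutes the block and f is monotone, these extremes are f o and f (o + m.-1), and f
    jumps by one at the end of the block. So the indices 1, 2, ... correspond to f o, ..., f (o + m)
    - 1. *)
Lemma I_chain_refine s (N := sumn (chain_type s)) (b := reshape_index (chain_type s))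
    (sig : 'S_N) (f h : nat -> nat) :
  all (ltn 0) (chain_type s) -> block_inv b sig ->
  (forall i, f i <= f i.+1 <= (f i).+1) -> 0 < f 0 ->
  (forall i, b i != b i.+1 -> f i.+1 = (f i).+1) ->
  (forall i, i < N -> h i = f (nperm sig i)) ->
  I_chain s h = refine 0 s f (f \o nperm sig).
Proof.
move=> s0 sigb f_step f0 f_break hE.
have f_mono : {homo f : i j / i <= j}.
  by apply: homo_leq => [//|? ? ?|i]; [exact: leq_trans | case/andP: (f_step i)].
case Es : s => [|c0 s'].
  by rewrite /I_chain /= (size0nil (_ : size (enum 'I_0) = 0)) // size_enum_ord.
rewrite -Es; clear Es s'.
rewrite -(flatten_refine (c0 := c0) (G := fun k => I_cube (nth c0 s k)
  (block_fun (chain_type s) h k))) => [|k ks /=].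
  rewrite /I_chain -val_enum_ord -map_comp; congr flatten.
  by apply: eq_map => k /=; rewrite /nth_cube (tnth_nth c0).
rewrite add0n; set c := nth c0 s k; set o := sumn _; set m := cube_dim c.
have typE : chain_type s = take k (chain_type s) ++ m :: drop k.+1 (chain_type s).
  rewrite -[LHS](cat_take_drop k) (drop_nth 0) ?size_map //.
  by rewrite (nth_map c0).
have mE : nth 0 (chain_type s) k = m by rewrite (nth_map c0).
have bk y : (b y == k) = (o <= y < o + m).
  have := @reshape_index_mid (take k (chain_type s)) m (drop k.+1 (chain_type s)) y.
  rewrite -typE size_takel ?size_map ?(ltnW ks) // => -> //.
  by apply/allP => x /mem_take; exact: (allP s0).
have m0 : 0 < m by move: s0; rewrite typE all_cat => /and3P [].
have oN : o + m <= N by rewrite /N typE sumn_cat /= addnA leq_addr.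
(* The index b also jumps at N, so the last block is covered. *)
have f_end : f (o + m) = (f (o + m.-1)).+1.
  rewrite -(prednK m0) addnS f_break //.
  have /eqP -> : b (o + m.-1) == k by rewrite bk; lia.
  by rewrite eq_sym bk; lia.
have sig_in y : o <= y < o + m -> o <= nperm sig y < o + m.
  by move=> yb; rewrite -bk (block_invP _ _ sigb) ?bk //; lia.
have sigV_in y : o <= y < o + m -> exists2 i, i < m & nperm sig (o + i) = y.
  move=> yb; have yN : y < N by lia.
  have : o <= nperm sig^-1 y < o + m.
    rewrite -bk -(block_invP _ _ sigb) ?ltn_nperm //.
    by rewrite npermKV bk.
  by exists (nperm sig^-1 y - o); [lia | rewrite subnKC ?npermKV //; lia].
have hb i : i < m -> f o <= h (o + i) < f (o + m).
  move=> im; rewrite hE; last by lia.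
  have /andP [lo hi] := sig_in (o + i) ltac:(lia).
  by rewrite f_mono //= f_end ltnS f_mono; lia.
have [i0 i0m i0E] := sigV_in o ltac:(lia).
have [i1 i1m i1E] := sigV_in (o + m.-1) ltac:(lia).
have minE :
    \big[minn/h (flatten_index (chain_type s) k 0)]_(j < nth 0 (chain_type s) k)
      h (flatten_index (chain_type s) k j) = f o.
  rewrite mE /flatten_index -/o.
  rewrite (bigmin_attained (i0 := Ordinal i0m)) ?mem_index_enum //=.
  - by rewrite hE ?i0E //; lia.
  - by rewrite hE ?i0E; have := hb 0 m0; lia.
  - by move=> i _; rewrite hE ?i0E; have := hb i (ltn_ord i); lia.
have blockE i : block_fun (chain_type s) h k i = h (o + i) + 1 - f o.
  by rewrite /block_fun minE.
have maxE : \max_(i < m) block_fun (chain_type s) h k i = f (o + m) - f o.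
  apply/eqP; rewrite eqn_leq; apply/andP; split.
    by apply/bigmax_leqP => i _; rewrite blockE; have := hb i (ltn_ord i); lia.
  apply: leq_trans (leq_bigmax (Ordinal i1m)); rewrite blockE /= hE ?i1E ?f_end; lia.
have fo : 0 < f o by apply: leq_trans f0 _; exact: f_mono.
rewrite /I_cube maxE -{2}(prednK fo) [in RHS]iota_shift -map_comp.
apply/eq_in_map => t; rewrite mem_iota => /andP [t0 _] /=.
rewrite (dfaceE c (fun i => u t (block_fun (chain_type s) h k i))); congr faces.
apply/eq_in_map => i; rewrite mem_iota /= => im.
rewrite blockE -hE; last by lia.
have := hb i im; rewrite /u; move: (h _) => y yb.
rewrite (_ : (y + 1 - f o == t) = (y == t + (f o).-1)); last by lia.
by rewrite (_ : (y + 1 - f o < t) = (y < t + (f o).-1)); last by lia.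
Qed.

End RefineChain.

(** * The functions tau as permutations *)

Section BreakFunctions.

Lemma mem_breaks t i : all (ltn 0) t -> i.+1 < sumn t ->
  (i.+1 \in breaks t) = (reshape_index t i != reshape_index t i.+1).
Proof.
elim: t i => //= m t IH i /andP [m0 t0] it; rewrite !reshape_index_cons.
have -> : (i.+1 \in breaks (m :: t)) =
    (0 < size t) && ((i.+1 == m) || (m <= i.+1) && (i.+1 - m \in breaks t)).
  rewrite /breaks /=; case: t {IH t0 it} => //= m' t.
  rewrite inE addn0; congr (_ || _).
  rewrite -[2]addn1 iotaDl -map_comp.
  apply/mapP/andP => [[k kt ->]|[mi /mapP [k kt e]]].
    by rewrite leq_addr addKn; split=> //; apply/mapP; exists k.
  by exists k; rewrite //= -e subnKC.
have t_pos : size t = 0 -> sumn t = 0 by move/size0nil ->.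
case: (ltngtP i.+1 m) => im.
- by rewrite andbF.
- rewrite /= subSn // IH //; last by lia.
  by rewrite eqSS; case: (size t) t_pos => //; lia.
- by rewrite andbT; case: (size t) t_pos => //; lia.
Qed.

Lemma rank_inj b x y : staircase b -> b x = b x.+1 -> b y = b y.+1 ->
  x - b x = y - b y -> x = y.
Proof.
move=> bs; wlog xy : x y / x < y.
  move=> H bx by' e; case: (ltngtP x y) => // lt_xy; first exact: H.
  by symmetry; exact: H.
move=> bx _ e; have : x.+1 - b x.+1 <= y - b y by exact: rank_mono.
by rewrite rank_step // e ltnn.
Qed.

(** Off the breaks, successive gaps have successive ranks, so the list in [sgn_n] reads the values
    of p in order. *)
Lemma rank_filter b M : staircase b ->
  [seq i - b i | i <- iota 0 M & b i == b i.+1] = iota 0 (M - b M).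
Proof.
move=> bs; elim: M => [|M IH]; first by rewrite sub0n.
rewrite -addn1 iotaD filter_cat map_cat IH /= add0n addn1.
have := bs.2 M; have := staircase_leq bs M; case: eqP => [bM|bM] le1 le2 /=.
  by rewrite -bM subSn // -[in RHS]addn1 iotaD add0n.
by rewrite cats0; congr iota; lia.
Qed.

Variables (typ : seq nat) (n : nat).
Let N := sumn typ.
Let b := reshape_index typ.
Hypotheses (typ0 : all (ltn 0) typ) (typ_n : N - size typ = n).

Let b_stair : staircase b := reshape_index_stair typ0.

Let rank_end : N.-1 - b N.-1 = n.
Proof.
have bN : b N = size typ by rewrite /b reshape_index_out.
case EN : N bN => [|M] bN; first by rewrite -typ_n EN sub0n.
have : b M <= M := staircase_leq b_stair M.
have : b M != size typ.
  rewrite /b ltn_eqF // reshape_indexP //; rewrite -/N EN //.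
by have := b_stair.2 M; rewrite bN -typ_n EN /=; lia.
Qed.

Definition tau_of (p : 'S_n) : {ffun 'I_N.-1 -> 'I_n.+2} :=
  [ffun i : 'I_N.-1 =>
    if b i != b i.+1 then ord_max else inord (nperm p (i - b i)).+1].

Lemma tau_ofE p (i : 'I_N.-1) : tau_of p i =
  (if b i != b i.+1 then n.+1 else (nperm p (i - b i)).+1) :> nat.
Proof.
rewrite ffunE; case: eqP => //= bi; rewrite inordK // ltnS ltnW //.
by rewrite ltnS ltn_nperm // -rank_end rank_lt.
Qed.

Lemma f_tau_height p j i : j <= n -> i < N ->
  f_tau (tau_of p) j i = height b p j i.
Proof.
move=> jn iN; congr _.+1.
rewrite (big_ord_widen N.-1 (fun x => step b p j x : nat)) -?sum1_card; last by lia.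
rewrite big_mkcond [RHS]big_mkcond; apply: eq_bigr => x _.
rewrite inE /= tau_ofE /step.
by case: (x < i) => //=; case: eqP; rewrite ltnS ?jn.
Qed.

Let mem_breaksE (i : 'I_N.-1) : (i.+1 \in breaks typ) = (b i != b i.+1).
Proof. by apply: mem_breaks => //; have := ltn_ord i; rewrite -/N; lia. Qed.

Lemma tau_of_values p :
  [seq tau_of p i : nat | i : 'I_N.-1 <- enum 'I_N.-1 & i.+1 \notin breaks typ] =
  [seq (p i).+1 | i : 'I_n].
Proof.
transitivity [seq (nperm p q).+1 | q <- iota 0 n].
  have -> : iota 0 n = [seq i - b i | i <- iota 0 N.-1 & b i == b i.+1].
    by rewrite rank_filter // rank_end.
  rewrite -val_enum_ord filter_map -!map_comp.
  rewrite (eq_filter (a2 := preim val (fun i => b i == b i.+1))); last first.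
    by move=> i; rewrite /= mem_breaksE negbK.
  apply/eq_in_map => i; rewrite mem_filter => /andP [/= bi _].
  by rewrite tau_ofE bi.
rewrite /image_mem -[iota 0 n]val_enum_ord -map_comp.
by apply: eq_map => i /=; rewrite npermE.
Qed.

Lemma values_inj (p q : 'S_n) :
  [seq (p i).+1 | i : 'I_n] = [seq (q i).+1 | i : 'I_n] -> p = q.
Proof.
move/eq_in_map => e; apply/permP => i; apply: val_inj; apply: succn_inj.
by apply: e; rewrite mem_enum.
Qed.

Lemma sgn_tau_of p : sgn_n (tau_of p) = ((-1) ^+ odd_perm p)%R.
Proof.
rewrite /sgn_n; case: pickP => [q|/(_ p)]; rewrite tau_of_values ?eqxx //.
by move/eqP/values_inj ->.
Qed.

(** Each value j + 1 with j < n is taken at some gap [pos j], necessarily off the breaks. The n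
    ranks of these gaps are distinct, hence exhaust all ranks, and p is the inverse of the map from
    j to the rank of [pos j]. *)
Lemma T_nP (tau : {ffun 'I_N.-1 -> 'I_n.+2}) :
  reflect (exists p, tau = tau_of p) (T_n tau).
Proof.
apply: (iffP andP) => [[/forallP T1 /forallP T2]|[p ->]]; last first.
  split; apply/forallP => j; apply/implyP; last first.
    by rewrite mem_breaksE => bi; rewrite tau_ofE bi.
  case/andP => j0 jn; have jn' : j.-1 < n by lia.
  have [|x [xN bx rx]] := @rank_onto _ b_stair N.-1 (nperm p^-1 j.-1).
    by rewrite rank_end ltn_nperm.
  apply/existsP; exists (Ordinal xN); apply/eqP/val_inj.
  by rewrite [LHS]tau_ofE /= bx eqxx -bx rx npermKV prednK.
have ex (j : 'I_n) : exists i, tau i == j.+1 :> nat.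
  have jn : j.+1 < n.+2 by rewrite !ltnS ltnW.
  have /existsP [i /eqP e] := implyP (T1 (Ordinal jn)) (ltn_ord j).
  by exists i; rewrite e.
pose pos j := xchoose (ex j).
have posP j : tau (pos j) = j.+1 :> nat by apply/eqP; exact: (xchooseP (ex j)).
have pos_flat j : b (pos j) = b (pos j).+1.
  apply/eqP; rewrite -[_ == _]negbK -mem_breaksE; apply/negP => /(implyP (T2 _)).
  by rewrite posP eqSS ltn_eqF.
have pos_lt j : pos j - b (pos j) < n by rewrite -rank_end rank_lt.
have h_inj : injective (fun j => Ordinal (pos_lt j)).
  move=> i j /(congr1 val) /= /(rank_inj b_stair (pos_flat i) (pos_flat j)) e.
  apply: val_inj; apply: succn_inj; rewrite -!posP; congr (nat_of_ord (tau _)).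
  exact: val_inj.
exists (perm h_inj)^-1%g; apply/ffunP => i; apply: val_inj; rewrite /= tau_ofE.
case: ifP => [bi|/negbFE/eqP bi].
  by apply/eqP; apply: (implyP (T2 i)); rewrite mem_breaksE.
have ri : i - b i < n by rewrite -rank_end rank_lt.
rewrite (npermE _ (Ordinal ri)); set j := _ (Ordinal ri).
have := permKV (perm h_inj) (Ordinal ri); rewrite -/j permE => /(congr1 val) /= e.
rewrite -posP; congr (nat_of_ord (tau _)); apply: val_inj.
exact: (rank_inj b_stair bi (pos_flat j) (esym e)).
Qed.

Lemma sum_T_n (V : zmodType) (F : int -> {ffun 'I_N.-1 -> 'I_n.+2} -> V) :
  (\sum_(tau | T_n tau) F (sgn_n tau) tau =
   \sum_(p : 'S_n) F ((-1) ^+ odd_perm p) (tau_of p))%R.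
Proof.
have tau_inj : injective tau_of.
  by move=> p q e; apply: values_inj; rewrite -!tau_of_values e.
transitivity (\sum_(tau in tau_of @: [set: 'S_n]) F (sgn_n tau) tau)%R.
  apply: eq_bigl => tau; apply/T_nP/imsetP => [[p ->]|[p _ ->]]; by exists p.
rewrite big_imset /=; last by move=> p q _ _; exact: tau_inj.
by apply: eq_big => p; rewrite ?inE // sgn_tau_of.
Qed.

End BreakFunctions.

Lemma lift_permP n (q j : 'I_n.+1) (p : 'S_n.+1) :
  reflect (exists p', p = lift_perm q j p') (p q == j).
Proof.
apply: (iffP eqP) => [pq|[p' ->]]; last by rewrite lift_perm_id.
have ex (k : 'I_n) : exists k', p (fintype.lift q k) == fintype.lift j k'.
  case: (unliftP j (p (fintype.lift q k))) => [k' ->|]; first by exists k'.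
  by rewrite -pq => /perm_inj/esym/eqP; rewrite (negPf (neq_lift _ _)).
pose g k := xchoose (ex k).
have gP k : p (fintype.lift q k) = fintype.lift j (g k).
  exact/eqP/(xchooseP (ex k)).
have g_inj : injective g.
  by move=> k l e; apply: (@lift_inj _ q); apply: (@perm_inj _ p); rewrite !gP e.
exists (perm g_inj); apply/permP => x.
by case: (unliftP q x) => [k|] ->; rewrite ?lift_perm_id // lift_perm_lift permE gP.
Qed.

Lemma sum_lift_perm (V : zmodType) n (F : 'S_n.+1 -> V) :
  (\sum_p F p = \sum_(q < n.+1) \sum_(p : 'S_n) F (lift_perm q ord_max p))%R.
Proof.
rewrite (partition_big (fun p : 'S_n.+1 => p^-1%g ord_max) xpredT) //=.
apply: eq_bigr => q _.
transitivity (\sum_(p in [set lift_perm q ord_max p' | p' in [set: 'S_n]]) F p)%R.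
  apply: eq_bigl => p.
  rewrite (canF_eq (permKV p)) eq_sym.
  apply/lift_permP/imsetP => [[p' ->]|[p' _ ->]]; by exists p'.
rewrite big_imset /=; last first.
  move=> p p' _ _ e; apply/permP => k; apply: (@lift_inj _ ord_max).
  by rewrite -!(lift_perm_lift q) e.
by apply: eq_bigl => p; rewrite inE.
Qed.

Local Open Scope quotient_scope.
Local Open Scope ring_scope.

Lemma freegU_mulrz (T : choiceType) (k z : int) (x : T) :
  << k *g x >> *~ z = << k * z *g x >> :> {freeg T / int}.
Proof.
rewrite -scaler_int intz; apply/eqP/freeg_eqP => y.
by rewrite coeffZ !coeffU mulrCA mulrA.
Qed.

(** * The boundary of the generators *)

Section HomologyClass.
Variables (R : realType) (X : topologicalType) (n : nat) (A B : set X).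
Let rel := @relative_cycles R X n A B.
Let hc := @homology_class R X n A B.

(** Chains that are not relative cycles have the default class 0, so additivity is stated on
    relative cycles. *)
Lemma homology_classD z1 z2 : z1 \in rel -> z2 \in rel ->
  hc (z1 + z2) = hc z1 + hc z2.
Proof.
move=> r1 r2; rewrite /hc /homology_class -raddfD; apply: congr1.
by apply: val_inj; rewrite raddfD /= !val_insubd r1 r2 rpredD.
Qed.

Lemma homology_class0 : hc 0 = 0.
Proof.
rewrite /hc /homology_class.
rewrite -[RHS](raddf0 (\pi_(Quotient.quot (@relative_boundaries R X n A B)))).
by apply: congr1; apply: val_inj; rewrite val_insubd rpred0.
Qed.

Lemma homology_class_sum I (l : seq I) (P : pred I) (F : I -> chain R X n) :
  (forall i, P i -> F i \in rel) ->
  hc (\sum_(i <- l | P i) F i) = \sum_(i <- l | P i) hc (F i).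
Proof.
move=> FP; elim: l => [|i l IH]; first by rewrite !big_nil homology_class0.
rewrite !big_cons; case: ifP => // Pi.
by rewrite homology_classD ?IH ?FP // rpred_sum.
Qed.

Lemma homology_class_mulrz z k : z \in rel -> hc (z *~ k) = hc z *~ k.
Proof.
move=> zr.
have nat_case m : hc (z *+ m) = hc z *+ m.
  elim: m => [|m IH]; first by rewrite !mulr0n homology_class0.
  by rewrite !mulrS homology_classD ?IH // rpredMn.
case: k => m; first by rewrite -!pmulrn.
rewrite NegzE !mulrNz -!pmulrn -nat_case.
apply/eqP; rewrite -subr_eq0 opprK -homology_classD ?rpredN ?rpredMn //.
by rewrite addNr homology_class0.
Qed.

End HomologyClass.

Lemma affine_simplex_comp (R : realType) (T : choiceType) m n (x : 'I_n.+1 -> T)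
    (h : 'I_m.+1 -> 'I_n.+1) :
  affine_simplex (R := R) x \o simplex_map h = affine_simplex (x \o h).
Proof.
apply/funext => t; apply/funext => y; rewrite /affine_simplex /=.
rewrite [RHS](partition_big h (fun i => x i == y)) //=.
apply: eq_bigr => i /eqP xi; rewrite mxE; apply: eq_bigl => j /=.
by case: (eqVneq (h j) i) => [->|]; rewrite ?andbF // xi eqxx.
Qed.

Lemma continuous_affine_simplex (R : realType) (T : choiceType) (le : T -> T -> Prop)
    (P : set T) n (x : 'I_n.+1 -> T) : flag le P x ->
  continuous (affine_simplex x : std_simplex R n -> realization_space R le P).
Proof.
by move=> xP; apply/continuousP => U oU; exact: oU.
Qed.

Local Open Scope nat_scope.

(** * Subdivided chains and flags *)

Section Subdivision.
Variable K : precubical.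
Implicit Types (s : seq K) (v w : K).

Lemma subdivideE s (k : 'I_(size s)) (A : {set 'I_(cube_dim (nth_cube k))}) :
  subdivide A = take k s ++ split_cube (mem_nat A) (nth_cube k) ++ drop k.+1 s.
Proof.
by rewrite /subdivide /split_cube -(dface_onE false A) -(dface_onE true A).
Qed.

Lemma cat_nth_cube s (k : 'I_(size s)) :
  s = take k s ++ nth_cube k :: drop k.+1 s.
Proof.
rewrite /nth_cube (tnth_nth (tnth (in_tuple s) k)) /= -drop_nth //.
by rewrite cat_take_drop.
Qed.

Lemma chain_typeE s (k : 'I_(size s)) : chain_type s =
  take k (chain_type s) ++ cube_dim (nth_cube k) :: drop k.+1 (chain_type s).
Proof.
by rewrite /chain_type -map_take -map_drop -map_cons -map_cat -cat_nth_cube.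
Qed.

Lemma chain_type_subdivide s (k : 'I_(size s))
    (A : {set 'I_(cube_dim (nth_cube k))}) :
  chain_type (subdivide A) = take k (chain_type s) ++
    #|A| :: (cube_dim (nth_cube k) - #|A|) :: drop k.+1 (chain_type s).
Proof.
by rewrite subdivideE chain_type_split count_mem_nat /chain_type map_take map_drop.
Qed.

Lemma sumn_subdivide s (k : 'I_(size s)) (A : {set 'I_(cube_dim (nth_cube k))}) :
  sumn (chain_type (subdivide A)) = sumn (chain_type s).
Proof.
rewrite chain_type_subdivide [in RHS](chain_typeE k) !sumn_cat /=.
by congr (_ + _); rewrite addnA subnKC // -[leqRHS]card_ord max_card.
Qed.

Lemma size_subdivide s (k : 'I_(size s)) (A : {set 'I_(cube_dim (nth_cube k))}) :
  size (subdivide A) = (size s).+1.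
Proof.
have := congr1 size (cat_nth_cube k); rewrite subdivideE !size_cat /=; lia.
Qed.

Lemma is_cube_chain_subdivide v w s (k : 'I_(size s))
    (A : {set 'I_(cube_dim (nth_cube k))}) :
  0 < #|A| < cube_dim (nth_cube k) -> is_cube_chain v s w ->
  is_cube_chain v (subdivide A) w.
Proof.
move=> A0; rewrite {1}(cat_nth_cube k) subdivideE; apply: is_cube_chain_split.
by rewrite count_mem_nat.
Qed.

(** This is I_c(f_j sigma). N is a parameter so that a chain and its subdivisions, whose sums are
    only provably equal, share ['S_N]. *)
Definition vertices N n s (p : 'S_n) (sig : 'S_N) (j : nat) : seq K :=
  let f := height (reshape_index (chain_type s)) p j in
  refine 0 s f (f \o nperm sig).

(* The rank, among the gaps off the breaks, of the cut of block k after r      *)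
(* positions.                                                                  *)
Definition gap s (k : nat) r := sumn (take k (chain_type s)) + r - k.+1.

Section Block.
Variables (N : nat) (s : seq K) (k : 'I_(size s)).
Let b := reshape_index (chain_type s).
Let m := cube_dim (nth_cube k).
Let o := sumn (take k (chain_type s)).
Hypotheses (s0 : all (ltn 0) (chain_type s)) (sN : sumn (chain_type s) = N).

Lemma block_bound : o + m <= N.
Proof. by rewrite -sN (chain_typeE k) sumn_cat /= addnA leq_addr. Qed.

Lemma block_index y : (b y == k) = (o <= y < o + m).
Proof.
have := @reshape_index_mid (take k (chain_type s)) m (drop k.+1 (chain_type s)) y.
rewrite -chain_typeE size_takel ?size_map ?(ltnW (ltn_ord k)) // => -> //.
by apply/allP => x /mem_take; exact: (allP s0).
Qed.

Lemma subdivide_index (A : {set 'I_m}) y :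
  reshape_index (chain_type (subdivide A)) y = b y + (o + #|A| <= y).
Proof.
rewrite chain_type_subdivide reshape_index_split -?chain_typeE //.
by rewrite -[leqRHS]card_ord max_card.
Qed.

Lemma gap_rank r : 0 < r < m -> [/\ o + r.-1 < N,
  b (o + r.-1) = b (o + r.-1).+1 & o + r.-1 - b (o + r.-1) = gap s k r].
Proof.
move=> rm; have om := block_bound; have b1 : b (o + r.-1) = k.
  by apply/eqP; rewrite block_index; lia.
have b2 : b (o + r.-1).+1 = k by apply/eqP; rewrite block_index; lia.
by rewrite b2 b1 /gap -/o; split; lia.
Qed.

(** The lifted permutation has its maximum at the cut of block k after [#|A|] positions. By
    [height_lift] the height function is that of the finer type; it jumps at the cut for every j <=
    n and sig respects the pieces, so [refine_split] applies. *)
Lemma vertices_subdivide n (q : 'I_n.+1) (p : 'S_n) (A : {set 'I_m})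
    (rho sig : 'S_N) j :
  N - size s = n.+1 -> 0 < #|A| < m -> q = gap s k #|A| :> nat ->
  is_shuffle o m (mem_nat A) rho ->
  block_inv (reshape_index (chain_type (subdivide A))) sig -> j <= n ->
  vertices s (lift_perm q ord_max p) (rho * sig)%g j = vertices (subdivide A) p sig j.
Proof.
move=> sn Am qE rhoP sigb jn.
have b_st : staircase b by exact: reshape_index_stair.
have bN : N - b N = n.+1 by rewrite -sn /b reshape_index_out ?sN // size_map.
have [xN bx rx] := gap_rank Am; set x := o + #|A|.-1 in xN bx rx.
set c := reshape_index (chain_type (subdivide A)) in sigb *.
have cE y : c y = b y + (x < y).
  by rewrite /c subdivide_index /x; congr (_ + nat_of_bool _); lia.
have hE i : i <= N -> height b (lift_perm q ord_max p) j i = height c p j i.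
  exact: (height_lift p b_st bN xN bx (etrans rx (esym qE)) cE jn).
rewrite /vertices -/b -/c.
rewrite (eq_refine (f' := height c p j) (h' := height c p j \o nperm (rho * sig)));
  [|by move=> i iN; rewrite hE // add0n -sN|
    by move=> i iN; rewrite /= hE // ltnW // ltn_nperm // add0n -sN].
have om := block_bound.
have cb y y' : c y = c y' -> (o <= y < o + #|A|) = (o <= y' < o + #|A|) /\
     (o + #|A| <= y < o + m) = (o + #|A| <= y' < o + m).
  have key := block_cases om (proj2 (andP Am)) (staircase_mono b_st) block_index.
  rewrite /c !subdivide_index; have := key y; have := key y'; lia.
rewrite [in LHS](cat_nth_cube k) subdivideE.
have oE : o = sumn (chain_type (take k s)) by rewrite /chain_type map_take.
have cA : count (mem_nat A) (iota 0 (cube_dim (nth_cube k))) = #|A|.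
  exact: count_mem_nat.
apply: (@refine_split K N); rewrite -?oE ?cA -?cat_nth_cube //.
- by rewrite sN.
- exact: height_mono.
- rewrite -{2}(prednK (proj1 (andP Am))) addnS heightS -/x /step.
  by rewrite !cE bx ltnn ltnSn addn0 addn1 ltn_eqF // addn1.
- move=> y yb; have yN : y < N by lia.
  by have [<- _] := cb _ _ (esym (block_invP _ _ sigb y yN)).
- move=> y yb; have yN : y < N by rewrite -/m in yb; lia.
  by have [_ <-] := cb _ _ (esym (block_invP _ _ sigb y yN)).
Qed.

End Block.

(** For j = n only breaks separate values, so all words consist of stars. *)
Lemma vertices_last n s N (p : 'S_n) (sig : 'S_N) :
  all (ltn 0) (chain_type s) -> sumn (chain_type s) = N -> N - size s = n ->
  block_inv (reshape_index (chain_type s)) sig -> vertices s p sig n = s.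
Proof.
move=> s0 sN sn sigb; set b := reshape_index _ in sigb.
have b_st : staircase b by exact: reshape_index_stair.
have bN : N - b N = n by rewrite -sn /b reshape_index_out ?sN // size_map.
have hE := height_last p b_st bN.
apply: (refine_id (d := 1)) => // i; rewrite sN add0n => iN.
  by rewrite hE // add1n.
by rewrite /= !hE ?(ltnW iN) ?(ltnW (ltn_nperm _ iN)) // (block_invP _ _ sigb).
Qed.

Lemma chain_le_subdivide s (k : 'I_(size s)) (A : {set 'I_(cube_dim (nth_cube k))}) :
  0 < #|A| < cube_dim (nth_cube k) -> chain_le (subdivide A) s.
Proof. by move=> A0; apply: rt_step; exists k, A. Qed.

(** The place of the maximum of p determines k and r; A is the set that sig sends to the first r
    positions of block k. *)
Lemma subdivide_decomp s N n (p : 'S_n.+1) (sig : 'S_N) :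
  all (ltn 0) (chain_type s) -> sumn (chain_type s) = N -> N - size s = n.+1 ->
  block_inv (reshape_index (chain_type s)) sig ->
  exists (k : 'I_(size s)) (A : {set 'I_(cube_dim (nth_cube k))})
      (p' : 'S_n) (sig' : 'S_N),
    [/\ 0 < #|A| < cube_dim (nth_cube k),
      block_inv (reshape_index (chain_type (subdivide A))) sig' &
      forall j, j <= n -> vertices s p sig j = vertices (subdivide A) p' sig' j].
Proof.
move=> s0 sN sn sigb; set b := reshape_index _ in sigb.
have b_st : staircase b by exact: reshape_index_stair.
have bN : N - b N = n.+1 by rewrite -sn /b reshape_index_out ?sN // size_map.
pose q := (p^-1)%g ord_max.
have /lift_permP [p' pE] : p q == ord_max by rewrite /q permKV.
have [|x [xN bx rx]] := @rank_onto _ b_st N q; first by rewrite bN.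
have ks : b x < size s.
  by rewrite -(size_map (@cube_dim K)) /b reshape_indexP // sN.
pose k := Ordinal ks; set o := sumn (take k (chain_type s)).
have om := block_bound k sN; rewrite -/o in om.
have bk := block_index k s0; rewrite -/o -/b in bk.
have xo : o <= x < o + cube_dim (nth_cube k) by rewrite -bk.
have xo1 : o <= x.+1 < o + cube_dim (nth_cube k) by rewrite -bk -bx.
pose r := x.+1 - o.
have rm : r < cube_dim (nth_cube k) by lia.
pose A := first_part o (cube_dim (nth_cube k)) r sig.
have Ar : #|A| = r by exact: (card_first_part om rm bk).
have [rho rhoP _] := shuffle_exists om (mem_nat A).
have A0 : 0 < #|A| < cube_dim (nth_cube k) by rewrite Ar rm andbT; lia.
have sigE : sig = (rho * (rho^-1 * sig))%g by rewrite mulgA mulgV mul1g.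
have sigb' : block_inv (reshape_index (chain_type (subdivide A))) (rho^-1 * sig)%g.
  rewrite (block_inv_split (b := b) (k := k) om rm _ bk _ _ rhoP) //.
  - by rewrite -sigE sigb eqxx.
  - exact: staircase_mono.
  - by move=> y; rewrite subdivide_index Ar.
exists k, A, p', (rho^-1 * sig)%g; split=> // j jn.
rewrite {1}sigE pE; apply: vertices_subdivide => //.
by rewrite /gap -/o Ar -rx /=; lia.
Qed.

Lemma chain_dim_subdivide n s (k : 'I_(size s))
    (A : {set 'I_(cube_dim (nth_cube k))}) :
  chain_dim s = n.+1 -> chain_dim (subdivide A) = n.
Proof. by rewrite /chain_dim sumn_subdivide size_subdivide subnS => ->. Qed.

(** Induction on n: the last vertex is s, and the others form the flag of a subdivision of s. *)
Lemma vertices_flag v w n s N (p : 'S_n) (sig : 'S_N) :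
  is_cube_chain v s w -> sumn (chain_type s) = N -> chain_dim s = n ->
  block_inv (reshape_index (chain_type s)) sig ->
  flag (@chain_le K) (Ch_le v w n) (fun j : 'I_n.+1 => vertices s p sig j).
Proof.
elim: n s p sig => [|n IH] s p sig s_chain sN sn sigb.
  have s0 := is_cube_chain_pos s_chain.
  have vE (i : 'I_1) : vertices s p sig i = s.
    by rewrite (ord1 i) vertices_last // -sN.
  split=> [i|i j _]; rewrite !vE; last exact: rt_refl.
  by split=> //=; rewrite sn.
have s0 := is_cube_chain_pos s_chain.
have sn' : N - size s = n.+1 by rewrite -sN.
have vmax : vertices s p sig n.+1 = s by exact: vertices_last.
have [k [A [p' [sig' [A0 sigb' vE]]]]] := subdivide_decomp p s0 sN sn' sigb.
have A_chain := is_cube_chain_subdivide A0 s_chain.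
have A_N := etrans (sumn_subdivide A) sN.
have A_n := chain_dim_subdivide A sn.
have [flag_in flag_le] := IH _ p' sig' A_chain A_N A_n sigb'.
have last_le : chain_le (vertices s p sig n) s.
  rewrite vE // vertices_last //.
  - exact: chain_le_subdivide.
  - exact: is_cube_chain_pos A_chain.
  - by rewrite -A_N.
have vE' (i : 'I_n.+2) (i_n : i <= n) :
    vertices s p sig i = vertices (subdivide A) p' sig' (Ordinal (i_n : i < n.+1)).
  exact: vE.
have max_eq (i : 'I_n.+2) : ~~ (i <= n) -> vertices s p sig i = s.
  by rewrite -ltnNge => ni; rewrite (_ : i = n.+1 :> nat) //; have := ltn_ord i; lia.
split=> [i|i j ij].
  have [i_n|/max_eq->] := boolP (i <= n); last by split=> //=; rewrite sn.
  have [? le_n] := flag_in (Ordinal (i_n : i < n.+1)).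
  by rewrite vE'; split=> //; exact: leqW.
have [j_n|/max_eq->] := boolP (j <= n).
  have i_n := leq_trans ij j_n.
  by rewrite !vE'; exact: flag_le.
have [i_n|/max_eq->] := boolP (i <= n); last exact: rt_refl.
apply: rt_trans last_le; rewrite vE' vE //.
exact: (flag_le (Ordinal (i_n : i < n.+1)) ord_max).
Qed.

End Subdivision.

Local Open Scope classical_set_scope.
Local Open Scope ring_scope.

Section Generators.
Variables (R : realType) (K : precubical) (v w : K).
Let X := Ch_space R v w.
Implicit Type s : seq K.

Definition simplex n (x : nat -> seq K) : std_simplex R n -> X :=
  affine_simplex (fun j : 'I_n.+1 => x j).

Definition gen N n s : chain R X n :=
  \sum_(sig : 'S_N | block_inv (reshape_index (chain_type s)) sig)
  \sum_(p : 'S_n) << (-1) ^+ odd_perm sig * (-1) ^+ odd_perm p *g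
                     @simplex n (vertices s p sig) >>.

Lemma generator_chainE s N n : is_cube_chain v s w ->
  sumn (chain_type s) = N -> chain_dim s = n ->
  generator_chain R v w n s = gen N n s.
Proof.
move=> s_chain sN sn; have s0 := is_cube_chain_pos s_chain.
case: N / sN; apply: eq_bigr => sig sigb.
have tn : (sumn (chain_type s) - size (chain_type s) = n)%N by rewrite size_map.
pose F (z : int) (tau : {ffun 'I_(sumn (chain_type s)).-1 -> 'I_n.+2}) :
    chain R X n := << (-1) ^+ sig * z *g affine_simplex (fun j : 'I_n.+1 =>
      I_chain s (fun i => f_tau tau j (perm_nat sig i))) >>.
rewrite (sum_T_n s0 tn F); apply: eq_bigr => p _.
congr << _ *g affine_simplex _ >>; apply/funext => j.
set b := reshape_index (chain_type s) in sigb *.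
rewrite (@I_chain_refine _ s sig (height b p j)) //.
- exact: height_step.
- by move=> i bi; rewrite heightS /step bi addn1.
- move=> i iN; rewrite (f_tau_height s0 tn) ?ltn_nperm //.
  by rewrite -ltnS ltn_ord.
Qed.

Lemma simplex_face n (x : nat -> seq K) (i : 'I_n.+2) :
  singular_face i (@simplex n.+1 x) = @simplex n (fun j => x (bump i j)).
Proof. by rewrite /singular_face /simplex affine_simplex_comp. Qed.

Lemma gen_singular_in N n s : is_cube_chain v s w ->
  sumn (chain_type s) = N -> chain_dim s = n ->
  gen N n s \in @singular_in R X (@skeleton K R v w n) n.
Proof.
move=> s_chain sN sn; rewrite rpred_sum // => sig sigb; rewrite rpred_sum // => p _.
have [x_in x_le] := vertices_flag (n := n) p s_chain sN sn sigb.
apply/asboolP => x; rewrite mem_dom coeffU mulf_eq0 negb_or pnatr_eq0 eqb0 negbK.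
case/andP => _ /eqP <-; split.
  by apply: continuous_affine_simplex; split=> // i; have [] := x_in i.
move=> y yx; exists n, (fun j : 'I_n.+1 => vertices s p sig j).
by split.
Qed.

Section Boundary.
Variables (N n : nat) (s : seq K).
Hypotheses (s_chain : is_cube_chain v s w) (sN : sumn (chain_type s) = N).
Hypothesis sn : chain_dim s = n.+1.
Let b := reshape_index (chain_type s).

Let s0 : all (ltn 0%N) (chain_type s) := is_cube_chain_pos s_chain.
Let b_stair : staircase b := reshape_index_stair s0.
Let typ_n : (N - size s = n.+1)%N. Proof. by rewrite -sN. Qed.
Let b_rank : (N - b N = n.+1)%N.
Proof. by rewrite /b reshape_index_out ?sN // size_map. Qed.

Definition face_term i (sig : 'S_N) (p : 'S_n.+1) : chain R X n :=
  << (-1) ^+ odd_perm sig * (-1) ^+ odd_perm p * (-1) ^+ i *g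
     @simplex n (fun j => vertices s p sig (bump i j)) >>.

Lemma boundary_terms : boundary (gen N n.+1 s) =
  \sum_(i < n.+2) \sum_(sig | block_inv b sig) \sum_p face_term i sig p.
Proof.
rewrite /gen raddf_sum exchange_big; apply: eq_bigr => sig _.
rewrite raddf_sum exchange_big; apply: eq_bigr => p _ /=.
by rewrite boundaryU; apply: eq_bigr => i _; rewrite simplex_face.
Qed.

(** The values i - 1 and i of p are told apart only by the omitted f_i; exchanging them reverses the
    sign. *)
Lemma face_term_inner i sig : (0 < i <= n)%N -> \sum_p face_term i sig p = 0.
Proof.
move=> i_n; have i1 : (i.-1 < n.+1)%N by lia.
have i2 : (i < n.+1)%N by lia.
have iS : Ordinal i2 = (Ordinal i1).+1 :> nat by rewrite /= prednK //; lia.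
have t_odd : odd_perm (tperm (Ordinal i1) (Ordinal i2)).
  by rewrite odd_tperm -val_eqE /= ltn_eqF //; lia.
apply: (sum_odd_perm0 (t := tperm (Ordinal i1) (Ordinal i2))) => // p.
rewrite /face_term freegUN odd_permM t_odd addbT.
rewrite signrN mulrN mulNr; congr << _ *g simplex _ >>; apply/funext => j.
have hE : height b (p * tperm (Ordinal i1) (Ordinal i2))%g (bump i j) =
    height b p (bump i j).
  by apply/funext => y; rewrite height_swap //= /bump; case: leqP; lia.
by rewrite /vertices -/b hE.
Qed.

(** For fixed p, the gap x where p is 0 separates values only in the omitted f_0. Composing sigma
    with the transposition of x and x + 1 keeps the simplex and reverses the sign. *)
Lemma face_term0 : \sum_(sig | block_inv b sig) \sum_p face_term 0 sig p = 0.
Proof.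
rewrite exchange_big big1 // => p _.
have [|x [xN bx rx]] := @rank_onto _ b_stair N (nperm p^-1%g 0).
  by rewrite b_rank ltn_nperm.
(* The index b is constant at x but jumps from N - 1 to N, so x is not the last position. *)
have x1N : (x.+1 < N)%N.
  rewrite ltn_neqAle xN andbT; apply/eqP => e.
  move: bx; rewrite e /b [RHS]reshape_index_out ?sN // => bx.
  have : (reshape_index (chain_type s) x < size (chain_type s))%N.
    by apply: reshape_indexP; rewrite sN.
  by rewrite bx ltnn.
have t_odd : odd_perm (tperm (Ordinal xN) (Ordinal x1N)).
  by rewrite odd_tperm -val_eqE /= ltn_eqF.
have tE y (f : nat -> nat) : f x = f x.+1 ->
    f (nperm (tperm (Ordinal xN) (Ordinal x1N)) y) = f y.
  by move=> fx; rewrite nperm_tperm /=; do 2?case: eqP => [->|_].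
apply: (sum_odd_perm0 (t := tperm (Ordinal xN) (Ordinal x1N))) => // sig.
  apply/block_invP/block_invP => sigb y yN.
    by have := sigb y yN; rewrite nperm_mul tE.
  by rewrite nperm_mul tE // sigb.
rewrite /face_term freegUN odd_permM t_odd addbT.
rewrite signrN !mulNr; congr << _ *g simplex _ >>; apply/funext => j.
rewrite /vertices; congr (refine 0 s _ _); apply/funext => y /=.
by rewrite nperm_mul tE // height_flat // rx npermKV.
Qed.

(** The shuffle contributes sgn(A), the insertion of the maximum n at q = [gap s k r] contributes
    (-1)^(q + n), and the face (-1)^(n + 1). The last two give (-1)^(q + 1), where q + k.+1 = o +
    r. *)
Lemma face_term_last (k : 'I_(size s)) r : (0 < r < cube_dim (nth_cube k))%N ->
  \sum_(sig | block_inv b sig)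
    \sum_(p : 'S_n) face_term n.+1 sig (lift_perm (inord (gap s k r)) ord_max p) =
  \sum_(A : {set 'I_(cube_dim (nth_cube k))} | #|A| == r)
    gen N n (subdivide A) *~
      ((-1) ^+ (sumn (take k (chain_type s)) + k.+1 + r + 1) * sgn_set A).
Proof.
move=> rm; set m := cube_dim (nth_cube k) in rm *.
set o := sumn (take k (chain_type s)).
have om := block_bound k sN; rewrite -/o -/m in om.
have bk := block_index k s0; rewrite -/o -/m -/b in bk.
have [xN bx rx] := gap_rank s0 sN rm; rewrite -/o -/b in xN bx rx.
have gap_lt : (gap s k r < n.+1)%N by rewrite -rx -b_rank rank_lt.
have /choice [rho rhoP] (A : {set 'I_m}) : exists rho : 'S_N,
    is_shuffle o m (mem_nat A) rho /\
    odd_perm rho = odd (\sum_(i < m) mem_nat A i * i + \sum_(i < #|A|) i)%N.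
  have [rho rho1 rho2] := shuffle_exists om (mem_nat A).
  by exists rho; rewrite rho2 count_mem_nat.
have [_ r_m] := andP rm.
rewrite (sum_split_block om r_m (staircase_mono b_stair) bk (fun=> erefl) _
  (fun A => (rhoP A).1)).
apply: eq_bigr => A /eqP Ar; rewrite /gen mulrz_suml; apply: eq_big => [sig|sig sigb].
  by apply: eq_forallb => i; rewrite !subdivide_index // Ar.
rewrite mulrz_suml; apply: eq_bigr => p _.
rewrite freegU_mulrz /face_term.
have A_m : (0 < #|A| < m)%N by rewrite Ar.
have sigb' : block_inv (reshape_index (chain_type (subdivide A))) sig.
  move: sigb; apply: etrans; apply: eq_forallb => i.
  by rewrite !subdivide_index // Ar.
have q_gap : (inord (gap s k r) : 'I_n.+1) = gap s k #|A| :> nat.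
  by rewrite inordK ?Ar.
have -> : @simplex n (fun j => vertices s (lift_perm (inord (gap s k r)) ord_max p)
    (rho A * sig)%g (bump n.+1 j)) = @simplex n (vertices (subdivide A) p sig).
  congr affine_simplex; apply/funext => j.
  rewrite /bump leqNgt ltn_ord add0n.
  by apply: vertices_subdivide => //; [exact: (rhoP A).1 | rewrite -ltnS].
congr << _ *g _ >>.
rewrite odd_permM (rhoP A).2 odd_lift_perm inordK // sgn_set_odd.
rewrite -(signr_odd _ (_ + 1)) -(signr_odd _ n.+1) -!signr_addb.
congr (_ ^+ nat_of_bool _).
have ko : (k <= o + r)%N.
  have := staircase_leq b_stair (o + r.-1).
  have /eqP -> : b (o + r.-1) == k by rewrite bk; lia.
  lia.
have : odd (gap s k r + k.+1) = odd (o + r).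
  rewrite /gap subnK //; have := staircase_leq b_stair (o + r.-1).
  have /eqP -> : b (o + r.-1) == k by rewrite bk; lia.
  lia.
set z := odd (\sum_(_ < m) _ + _) => gap_odd.
have -> : odd (o + k.+1 + r + 1) = ~~ odd (gap s k r).
  by move: gap_odd; rewrite !oddD /=; do 4!case: odd.
by rewrite /=; case: z; case: odd; case: odd; case: (odd_perm sig); case: (odd_perm p).
Qed.

Lemma boundary_gen : boundary (gen N n.+1 s) =
  \sum_(k < size s) \sum_(1 <= r < cube_dim (nth_cube k))
    \sum_(A : {set 'I_(cube_dim (nth_cube k))} | #|A| == r)
      gen N n (subdivide A) *~
        ((-1) ^+ (sumn (take k (chain_type s)) + k.+1 + r + 1) * sgn_set A).
Proof.
rewrite boundary_terms big_ord_recr /= big1 ?add0r => [|i _]; last first.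
  have [->|i0] := posnP i; first exact: face_term0.
  by rewrite big1 // => sig _; apply: face_term_inner; rewrite i0 -ltnS ltn_ord.
pose G q := \sum_(sig | block_inv b sig)
  \sum_(p : 'S_n) face_term n.+1 sig (lift_perm (inord q) ord_max p).
transitivity (\sum_(q < n.+1) G q).
  rewrite /G [RHS]exchange_big /=; apply: eq_bigr => sig _.
  rewrite sum_lift_perm; apply: eq_bigr => q _.
  by apply: eq_bigr => p _; rewrite inord_val.
have <- : \sum_(q < sumn (chain_type s) - size (chain_type s)) G q =
    \sum_(q < n.+1) G q.
  have : (sumn (chain_type s) - size (chain_type s) = n.+1)%N by rewrite size_map.
  by move: (sumn _ - _)%N => M ->.
rewrite sum_gaps // size_map.
apply: eq_bigr => k _.
rewrite (nth_map (nth_cube k)) // -[nth _ s k](tnth_nth _ (in_tuple s)).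
by apply: eq_big_nat => r rm; rewrite -face_term_last.
Qed.

End Boundary.

(** By [boundary_gen], the boundary is a combination of generators one dimension lower, whose
    simplices lie in the lower skeleton. *)
Lemma gen_relative_cycle N n s : is_cube_chain v s w ->
  sumn (chain_type s) = N -> chain_dim s = n ->
  gen N n s \in @relative_cycles R X n (@skeleton K R v w n) (@skeleton_lt K R v w n).
Proof.
move=> s_chain sN sn; rewrite inE gen_singular_in //=.
case: n sn => [|n] sn; first exact: rpred0.
rewrite /= boundary_gen //; apply: rpred_sum => k _.
rewrite big_nat; apply: rpred_sum => r rm; apply: rpred_sum => A /eqP Ar.
rewrite rpredMz //; apply: gen_singular_in.
- by apply: is_cube_chain_subdivide s_chain; rewrite Ar.
- by rewrite sumn_subdivide.
- exact: chain_dim_subdivide.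
Qed.

End Generators.

Theorem theorem1p10 (R : realType) (K : precubical) (v w : K)
  (K_finite : finite_set [set: K]) (v_vertex : cube_dim v = 0%N)
  (w_vertex : cube_dim w = 0%N) (K_proper : is_proper (length_covering K))
  (n : nat) (c : seq K) (c_chain : Ch v w c) (c_dim : chain_dim c = n) :
  cellular_diff (generator_class R v w n c) =
  \sum_(k < size c)
    \sum_(1 <= r < cube_dim (nth_cube k))
      \sum_(A : {set 'I_(cube_dim (nth_cube k))} | #|A| == r)
        generator_class R v w n.-1 (subdivide A) *~
          ((-1) ^+ (sumn (take k (chain_type c)) + k.+1 + r + 1) * sgn_set A).

Proof.
have s_chain : is_cube_chain v c w by [].
have cN : sumn (chain_type c) = sumn (chain_type c) by [].
rewrite /cellular_diff /generator_class (generator_chainE R s_chain cN c_dim).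
rewrite connecting_class; last exact: gen_relative_cycle.
case: n c_dim => [|n] c_dim.
  (* In dimension 0 the boundary vanishes and the sum is empty: a pair (k, r) would give a gap of
     rank less than 0. *)
  rewrite homology_class0 big1 // => k _; rewrite big_nat big1 // => r rm.
  have c0 := is_cube_chain_pos s_chain.
  have [xN bx _] := gap_rank c0 cN rm.
  have := rank_lt (reshape_index_stair c0) xN bx.
  rewrite [reshape_index _ (sumn _)]reshape_index_out // size_map.
  by rewrite -/(chain_dim c) c_dim.
have A_cycle k (A : {set 'I_(cube_dim (nth_cube (s := c) k))}) :
    (0 < #|A| < cube_dim (nth_cube k))%N ->
    gen R v w (sumn (chain_type c)) n (subdivide A) \in
      relative_cycles (@skeleton K R v w n) (@skeleton_lt K R v w n) /\
    generator_chain R v w n (subdivide A) =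
      gen R v w (sumn (chain_type c)) n (subdivide A).
  move=> A0; have A_chain := is_cube_chain_subdivide A0 s_chain.
  have A_dim := chain_dim_subdivide A c_dim.
  split; first by apply: gen_relative_cycle; rewrite ?sumn_subdivide.
  by apply: generator_chainE; rewrite ?sumn_subdivide.
rewrite /= boundary_gen // homology_class_sum => [|k _]; last first.
  rewrite big_nat; apply: rpred_sum => r rm; apply: rpred_sum => A /eqP Ar.
  by rewrite rpredMz // (A_cycle k A _).1 // Ar.
apply: eq_bigr => k _; rewrite [in LHS]big_nat [RHS]big_nat.
rewrite homology_class_sum => [|r rm]; last first.
  by apply: rpred_sum => A /eqP Ar; rewrite rpredMz // (A_cycle k A _).1 // Ar.
apply: eq_bigr => r rm; rewrite homology_class_sum => [|A /eqP Ar]; last first.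
  by rewrite rpredMz // (A_cycle k A _).1 // Ar.
apply: eq_bigr => A /eqP Ar; have [|A_rel ->] := A_cycle k A; first by rewrite Ar.
by rewrite homology_class_mulrz.
Qed.
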